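(* Let $f$ be a positive integer and for non-negative integers $n_1,\dots,n_f$ put $N_i:=n_i+n_{i+1}+\dots+n_f$ for $i=1,\dots,f$. Then for $|q|<1$, \begin{align*} &\sum_{m,n,n_1,\dots,n_f\geq 0}\frac{q^{2m^2+6mn+6n^2+m+3n+N_1^2+\dots+N_f^2}(q;q)_{n_f}}{(q;q)_m(q^3;q^3)_n(q;q)_{n_f-3n-2m}(q;q)_{n_1}\cdots(q;q)_{n_{f-1}}(q;q)_{2n_f}}\\ &\quad+q\sum_{m,n,n_1,\dots,n_f\geq 0}\frac{q^{2m^2+6mn+6n^2+3m+6n+N_1^2+\dots+N_f^2}(q;q)_{n_f}}{(q;q)_m(q^3;q^3)_n(q;q)_{n_f-3n-2m-1}(q;q)_{n_1}\cdots(q;q)_{n_{f-1}}(q;q)_{2n_f}} =\frac{(q^{f+2},q^{5f+4},q^{6f+6};q^{6f+6})_\infty(q^{4f+2},q^{8f+10};q^{12f+12})_\infty}{(q;q)_\infty}. \end{align*}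
   Context: $(a;p)_n=\prod_{k=0}^{n-1}(1-ap^k)$ for a base $p$, $(a_1,\dots,a_k;p)_n=(a_1;p)_n\cdots(a_k;p)_n$, and for $|p|<1$, $(a;p)_\infty=\lim_{n\to\infty}(a;p)_n$. By convention $1/(q;q)_n=0$ for negative integers $n$, so summands with a negative index in a denominator vanish. *)

(* Defs.v *)
From mathcomp Require Import all_boot all_order all_algebra finmap.
From mathcomp Require Import complex.
From mathcomp Require Import boolp classical_sets functions reals.
From mathcomp Require Import topology normedtype sequences.
From mathcomp.analysis.showcase Require Import summability.

Set Implicit Arguments.
Unset Strict Implicit.
Unset Printing Implicit Defensive.

Import Order.TTheory GRing.Theory Num.Theory.
Import numFieldNormedType.Exports.

Local Open Scope classical_set_scope.
Local Open Scope ring_scope.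

(* A numFieldType carries the topology of its norm, whereas R[i] is declared no
   topology of its own: limits in R[i] are obtained by taking C := R[i]. *)
Section QSeries.
Variable C : numFieldType.
Implicit Types (a p q : C) (s : seq C).

Definition qpoch a p (n : nat) : C := \prod_(0 <= k < n) (1 - a * p ^+ k).

Definition qpoch_inf a p : C := lim (qpoch a p @ \oo).

Definition qpochs_inf s p : C := \prod_(a <- s) qpoch_inf a p.

(* 1 / (q;q)_k for an integer k, with the convention that it is 0 for k < 0 *)
Definition inv_qpoch q (k : int) : C :=
  match k with
  | Posz n => (qpoch q q n)^-1
  | Negz _ => 0
  end.

(* The sum of x over the index type I is the limit of its finite partial sums
   along the filter of finite subsets of I ordered by inclusion, i.e. the
   unconditional sum. *)
Definition is_summable (I : choiceType) (x : I -> C) : Prop :=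
  cvg (partial_sum x @ totally).

Definition multisum (I : choiceType) (x : I -> C) : C :=
  summability.sum x.

End QSeries.

Section Summands.
Variables (f : nat) (C : numFieldType) (q : C).

(* n_i and N_i = n_i + ... + n_f, for i = 1, ..., f *)
Definition part (t : f.-tuple nat) (i : nat) : nat := nth 0%N t i.-1.

Definition tail_sum (t : f.-tuple nat) (i : nat) : nat :=
  (\sum_(i <= j < f.+1) part t j)%N.

Definition tail_sum_sq (t : f.-tuple nat) : nat :=
  (\sum_(1 <= i < f.+1) tail_sum t i ^ 2)%N.

Definition summand1 (x : nat * nat * f.-tuple nat) : C :=
  let: (m, n, t) := x in
  q ^+ (2 * m ^ 2 + 6 * m * n + 6 * n ^ 2 + m + 3 * n + tail_sum_sq t)
  * qpoch q q (part t f)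
  * inv_qpoch q ((part t f)%:Z - (3 * n)%:Z - (2 * m)%:Z)
  / (qpoch q q m * qpoch (q ^+ 3) (q ^+ 3) n
     * (\prod_(1 <= i < f) qpoch q q (part t i))
     * qpoch q q (2 * part t f)).

Definition summand2 (x : nat * nat * f.-tuple nat) : C :=
  let: (m, n, t) := x in
  q ^+ (2 * m ^ 2 + 6 * m * n + 6 * n ^ 2 + 3 * m + 6 * n + tail_sum_sq t)
  * qpoch q q (part t f)
  * inv_qpoch q ((part t f)%:Z - (3 * n)%:Z - (2 * m)%:Z - 1)
  / (qpoch q q m * qpoch (q ^+ 3) (q ^+ 3) n
     * (\prod_(1 <= i < f) qpoch q q (part t i))
     * qpoch q q (2 * part t f)).

End Summands.

(* Main.v *)
Require Import Defs.
From mathcomp Require Import all_boot all_order all_algebra finmap.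
From mathcomp Require Import complex.
From mathcomp Require Import boolp classical_sets functions reals.
From mathcomp Require Import topology normedtype sequences.
From mathcomp.analysis.showcase Require Import summability.
From mathcomp Require Import ring lra zify.

(** The sums over (m, n) at fixed n_f = L, multiplied by (q;q)_L / (q;q)_{2L}, form
    a Bailey pair relative to 1,
      beta_L = sum_{r in Z} c_r q^{r^2+r} / ((q;q)_{L-r} (q;q)_{L+r}),
    with c_r = 1, -1, 0 for r = 0, 1, 2 mod 3: both sides satisfy the recurrence
      S_L = (1 + q - q^{2L}) S_{L-1} - q (1 - q^{2L-1}) (1 - q^{2L-2}) S_{L-2}
    for S_L = (q;q)_{2L} beta_L. For the double sum this comes from the
    generating function (1 + y) (-q^3 y^3;q^3)_oo / (y^2;q)_oo, for the sum over r
    from the three-term recurrence of the Rogers-Szego polynomials. Iterating Bailey's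
    lemma f times turns the multisum into
      (q;q)_oo^{-1} sum_s c_s q^{(f+1)s^2+s},
    which is the quintuple product with base q^{6f+6} at z = q^{f+2}. *)

Set Implicit Arguments.
Unset Strict Implicit.
Unset Printing Implicit Defensive.

Import Order.TTheory GRing.Theory Num.Theory.
Import numFieldNormedType.Exports.

Local Open Scope classical_set_scope.
Local Open Scope ring_scope.

(** The second double sum, with its prefactor q, is what supplies the factor 1 + y of the generating
    function. In the functional equation relating y and q y, this factor cancels 1 + y against 1 -
    y^2 and 1 + q y against 1 + q^3 y^3. The recurrence of the coefficients thereby drops from four
    steps to three, and summation against 1/(q;q)_{L-M} leaves two. No formal power series occur: a
    generating function is a sequence on Z that vanishes at negative indices, and a functional
    equation is a recurrence between finite sums. The quintuple product is the limit of a rational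
    identity between finite sums, recentred at -z/p^m. The limits of such sums all come from one
    dominated convergence statement, [tannery], where the weights tend to a limit independent of the
    index. The analysis is done over an abstract numFieldType under the hypothesis [abs_complete],
    since R[i] has a topology only when viewed as such a field; the hypothesis is proved for R[i]
    from suprema of real sums. *)

Section QPochhammer.
Variable C : numFieldType.
Implicit Types a p q z : C.

Lemma qpoch0 a p : qpoch a p 0 = 1.
Proof. by rewrite /qpoch big_nil. Qed.

Lemma qpochSr a p n : qpoch a p n.+1 = qpoch a p n * (1 - a * p ^+ n).
Proof. by rewrite /qpoch big_nat_recr. Qed.

Lemma qpochS a p n : qpoch a p n.+1 = (1 - a) * qpoch (a * p) p n.
Proof.
rewrite /qpoch big_nat_recl// expr0 mulr1; congr (_ * _).
by apply: eq_bigr => i _; rewrite exprS mulrA.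
Qed.

Lemma qpoch_neq0 a p n :
  (forall i, (i < n)%N -> a * p ^+ i != 1) -> qpoch a p n != 0.
Proof.
elim: n => [|n IH] h; first by rewrite qpoch0 oner_neq0.
rewrite qpochSr mulf_neq0 ?IH// => [i ni|]; first by apply: h; lia.
by rewrite subr_eq0 eq_sym h.
Qed.

End QPochhammer.

(** * Finite bilateral sums *)

Section BilateralSum.
Variable V : zmodType.
Implicit Types F G : int -> V.

(** The cut-off [B] is independent of the support of [F], so that sums belonging to different L can
    be compared term by term over one range; shifts and reflections are exact once [B] exceeds the
    support. *)
Definition bisum (B : nat) F : V := \sum_(0 <= i < (2 * B).+1) F (i%:Z - B%:Z).

Lemma eq_bisum B F G : F =1 G -> bisum B F = bisum B G.
Proof. by move=> FG; apply: eq_bigr => i _; rewrite FG. Qed.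

Lemma bisumD B F G : bisum B (fun r => F r + G r) = bisum B F + bisum B G.
Proof. by rewrite /bisum big_split. Qed.

Lemma bisumS B F : bisum B.+1 F = F (- (B.+1)%:Z) + bisum B F + F B.+1%:Z.
Proof.
rewrite /bisum mulnS !addSn add0n big_nat_recr// big_nat_recl//=.
congr (_ + _ + _); first by congr F; lia.
  by apply: eq_bigr => i _; congr F; lia.
by congr F; lia.
Qed.

Lemma bisum_widen A B F : (A <= B)%N ->
  (forall r, (A < `|r|)%N -> F r = 0) -> bisum B F = bisum A F.
Proof.
move=> + F0; elim: B => [|B IH]; first by rewrite leqn0 => /eqP ->.
rewrite leq_eqVlt => /orP[/eqP <- //|AB]; rewrite bisumS !F0 ?IH ?add0r ?addr0//; lia.
Qed.

Lemma bisum_opp B F : bisum B (fun r => F (- r)) = bisum B F.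
Proof.
elim: B => [|B IH]; first by rewrite /bisum !big_nat1; congr F; lia.
by rewrite !bisumS IH opprK addrC [X in _ + X]addrC addrA.
Qed.

Lemma bisum_shift B F : (forall r, (B <= `|r|)%N -> F r = 0) ->
  bisum B (fun r => F (r + 1)) = bisum B F.
Proof.
move=> F0; rewrite /bisum big_nat_recr//= [RHS]big_nat_recl//.
rewrite [F (0%:Z - _)]F0 ?add0r; last by lia.
rewrite [X in _ + X]F0 ?addr0; last by lia.
by apply: eq_bigr => i _; congr F; lia.
Qed.

End BilateralSum.

Lemma bisumZl (A : pzRingType) B (a : A) F : bisum B (fun r => a * F r) = a * bisum B F.
Proof. by rewrite /bisum big_distrr. Qed.

(** * Three-term recurrence for the sum over r *)

Section InverseQPochhammer.
Variables (C : numFieldType) (q : C).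
Hypothesis q_lt1 : `|q| < 1.
Local Notation e := (inv_qpoch q).
Local Notation qz k := (q ^+ absz k).

Lemma subr1X_neq0 k : (0 < k)%N -> 1 - q ^+ k != 0.
Proof.
move=> k0; rewrite subr_eq0; apply/eqP => h.
have : `|q ^+ k| < 1 by rewrite normrX exprn_ilt1 // -lt0n.
by rewrite -h normr1 ltxx.
Qed.

Lemma qpochqq_neq0 n : qpoch q q n != 0.
Proof.
elim: n => [|n IH]; first by rewrite qpoch0 oner_neq0.
by rewrite qpochSr mulf_neq0// -exprS subr1X_neq0.
Qed.

(** Valid on all of Z: at k = 0 the factor 1 - q^0 yields the convention e (-1) = 0, and for k < 0
    both sides vanish, so the absolute value in the exponent is harmless. *)
Lemma inv_qpoch_pred k : e (k - 1) = (1 - qz k) * e k.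
Proof.
case: k => [[|n]|n]; last by rewrite mulr0.
  by rewrite expr0 subrr mul0r.
have -> : n.+1%:Z - 1 = n by lia.
rewrite /inv_qpoch qpochSr -exprS invfM mulrC -mulrA mulVf ?mulr1//.
by apply: subr1X_neq0.
Qed.

Lemma inv_qpoch_lt0 k : k < 0 -> e k = 0.
Proof. by case: k. Qed.

Lemma inv_qpochE (n : nat) : e n%:Z = (qpoch q q n)^-1.
Proof. by []. Qed.

Lemma expr_abszD (a b : int) : 0 <= a -> 0 <= b -> qz a * qz b = qz (a + b).
Proof. by move=> a0 b0; rewrite -exprD; congr (_ ^+ _); lia. Qed.

(* With [n, k] = (q;q)_n e(k) e(n-k), this is
   [n+1, k] = q^k [n, k] + q^(n+1-k) [n, k-1] + (1 - q^n) [n-1, k-1]. *)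
Lemma inv_qpoch_pascal (k m : int) : 0 <= k + m ->
  (1 - qz (k + m)) * (e k * e m) = qz k * (e k * e (m - 1)) +
    qz m * (e (k - 1) * e m) + e (k - 1) * e (m - 1).
Proof.
move=> km.
rewrite !inv_qpoch_pred.
have [k0|k0] := ltP k 0; first by rewrite (inv_qpoch_lt0 k0); ring.
have [m0|m0] := ltP m 0; first by rewrite (inv_qpoch_lt0 m0); ring.
rewrite -expr_abszD//; ring.
Qed.

Definition chi3 (r : int) : C :=
  if (r %% 3)%Z == 0 then 1 else if (r %% 3)%Z == 1 then -1 else 0.

(** The relation 1 + w + w^2 = 0 for a cube root of unity w. Together with the reflection [chi3N],
    this is all that [evsum_rec] and [odsum_rec] use about the coefficients. *)
Lemma chi3D r : chi3 (r + 2) = - (chi3 r + chi3 (r + 1)).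
Proof.
rewrite /chi3.
have : ((r %% 3)%Z = 0) \/ ((r %% 3)%Z = 1) \/ ((r %% 3)%Z = 2) by lia.
case=> [h|[h|h]]; rewrite h.
- have -> : ((r + 2) %% 3 = 2)%Z by lia.
  have -> : ((r + 1) %% 3 = 1)%Z by lia.
  by rewrite /=; ring.
- have -> : ((r + 2) %% 3 = 0)%Z by lia.
  have -> : ((r + 1) %% 3 = 2)%Z by lia.
  by rewrite /=; ring.
- have -> : ((r + 2) %% 3 = 1)%Z by lia.
  have -> : ((r + 1) %% 3 = 0)%Z by lia.
  by rewrite /=; ring.
Qed.

Lemma chi3N r : chi3 (- r) = - chi3 (r + 1).
Proof.
rewrite /chi3.
have : ((r %% 3)%Z = 0) \/ ((r %% 3)%Z = 1) \/ ((r %% 3)%Z = 2) by lia.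
case=> [h|[h|h]].
- have -> : ((- r) %% 3 = 0)%Z by lia.
  have -> : ((r + 1) %% 3 = 1)%Z by lia.
  by rewrite /=; ring.
- have -> : ((- r) %% 3 = 2)%Z by lia.
  have -> : ((r + 1) %% 3 = 2)%Z by lia.
  by rewrite /=; ring.
- have -> : ((- r) %% 3 = 1)%Z by lia.
  have -> : ((r + 1) %% 3 = 0)%Z by lia.
  by rewrite /=; ring.
Qed.

(* Up to the factors (q;q)_{2L} and (q;q)_{2L+1}, the sums evsum and odsum are
   the even and odd terms of a sequence of Rogers-Szego polynomials in base 1/q
   at a cube root of unity w. Their three-term recurrence becomes rational
   because (1 + w)^2 = w. *)
Definition evsum B (c : int -> C) (L : int) : C :=
  bisum B (fun r => c r * (qz (r * r) * (e (L - r) * e (L + r)))).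

Definition odsum B (c : int -> C) (L : int) : C :=
  bisum B (fun r => c r * (qz (r * (r + 1)) * (e (L - r) * e (L + 1 + r)))).

Definition shevsum B (c : int -> C) (L : int) : C :=
  bisum B (fun r => c r * (qz (r * (r + 1)) * (e (L - r) * e (L + r)))).

Lemma inv_qpochM0 (a b : int) : (a < 0) || (b < 0) -> e a * e b = 0.
Proof. by case/orP => /inv_qpoch_lt0 ->; rewrite ?mul0r ?mulr0. Qed.

Lemma evsumN B c L : evsum B (fun r => c (- r)) L = evsum B c L.
Proof.
rewrite /evsum -bisum_opp; apply: eq_bisum => r.
by rewrite opprK mulrNN; congr (_ * (_ * _)); rewrite mulrC.
Qed.

Lemma odsumN B c L : (L < B%:Z - 1) -> odsum B (fun r => c (- r - 1)) L = odsum B c L.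
Proof.
move=> LB; rewrite /odsum -[RHS]bisum_opp -[RHS]bisum_shift => [|r Br].
  apply: eq_bisum => r; congr (_ * (_ * _)); first by congr c; lia.
    by congr (_ ^+ _); lia.
  by rewrite mulrC; congr (_ * _); congr e; lia.
by rewrite inv_qpochM0 ?mulr0//; lia.
Qed.

Lemma evsumD B c d L : evsum B (fun r => c r + d r) L = evsum B c L + evsum B d L.
Proof. by rewrite /evsum -bisumD; apply: eq_bisum => r; rewrite mulrDl. Qed.

Lemma odsumD B c d L : odsum B (fun r => c r + d r) L = odsum B c L + odsum B d L.
Proof. by rewrite /odsum -bisumD; apply: eq_bisum => r; rewrite mulrDl. Qed.

(** Pascal's rule at (L+1-r, L+1+r) produces the even sum at L and two odd sums, with coefficients
    c_r and, after a shift, c_{r+1}. The reflection r -> -r-1 replaces c_r by -c_{r+2} = c_r +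
    c_{r+1}, so the two odd sums add up to a single one. *)
Lemma evsum_rec B (L : nat) : (L.+1 < B)%N ->
  (1 - q ^+ (2 * L).+2) * evsum B chi3 L.+1 =
    q ^+ L.+1 * odsum B chi3 L + evsum B chi3 L.
Proof.
move=> LB.
have -> : odsum B chi3 L = odsum B (fun r => chi3 r + chi3 (r + 1)) L.
  rewrite -[LHS]odsumN; last by lia.
  apply: eq_bisum => r; congr (_ * _).
  have -> : - r - 1 = - (r + 1) by ring.
  by rewrite chi3N -addrA chi3D opprK.
rewrite odsumD mulrDr.
have sh : odsum B (fun r => chi3 (r + 1)) L =
    bisum B (fun r => chi3 r * (qz ((r - 1) * r) * (e (L.+1%:Z - r) * e (L%:Z + r)))).
  rewrite -[RHS]bisum_shift => [|r Br]; last by rewrite inv_qpochM0 ?mulr0//; lia.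
  apply: eq_bisum => r; congr (_ * (_ * (_ * _))).
  - by congr (_ ^+ _); lia.
  - by congr e; lia.
  - by congr e; lia.
rewrite sh /evsum /odsum -!bisumZl -!bisumD; apply: eq_bisum => r.
have := @inv_qpoch_pascal (L.+1%:Z - r) (L.+1%:Z + r).
have -> : L.+1%:Z - r + (L.+1%:Z + r) = (2 * L).+2 by lia.
rewrite absz_nat => /(_ isT).
have -> : L.+1%:Z + r - 1 = L%:Z + r by lia.
have -> : L.+1%:Z - r - 1 = L%:Z - r by lia.
have -> : L%:Z + 1 + r = L.+1%:Z + r by lia.
move=> h.
rewrite mulrCA [X in _ * X]mulrCA h.
(* The exponents may be added only where the index of [e] is non-negative; elsewhere both sides are
   0. *)
have E1 : qz (r * r) * qz (L.+1%:Z - r) * e (L.+1%:Z - r) =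
   q ^+ L.+1 * qz ((r - 1) * r) * e (L.+1%:Z - r).
  have [k0|k0] := ltP (L.+1%:Z - r) 0; first by rewrite inv_qpoch_lt0 // !mulr0.
  congr (_ * _); rewrite expr_abszD//; last by nia.
  rewrite -[L.+1 in RHS]absz_nat expr_abszD//; last by nia.
  by congr (_ ^+ _); congr absz; lia.
have E2 : qz (r * r) * qz (L.+1%:Z + r) * e (L.+1%:Z + r) =
   q ^+ L.+1 * qz (r * (r + 1)) * e (L.+1%:Z + r).
  have [k0|k0] := ltP (L.+1%:Z + r) 0; first by rewrite inv_qpoch_lt0 // !mulr0.
  congr (_ * _); rewrite expr_abszD//; last by nia.
  rewrite -[L.+1 in RHS]absz_nat expr_abszD//; last by nia.
  by congr (_ ^+ _); congr absz; lia.
transitivity (chi3 r * (qz (r * r) * qz (L.+1%:Z - r) * e (L.+1%:Z - r)) * e (L%:Z + r) +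
  chi3 r * (qz (r * r) * qz (L.+1%:Z + r) * e (L.+1%:Z + r)) * e (L%:Z - r) +
  chi3 r * (qz (r * r) * (e (L%:Z - r) * e (L%:Z + r)))); first by ring.
rewrite E1 E2; ring.
Qed.

(** As for [evsum_rec], with Pascal's rule at (L-r, L+1+r); here the reflection r -> -r turns c_r
    into -c_{r+1} = c_r + c_{r-1}. *)
Lemma odsum_rec B (L : nat) : (L.+1 < B)%N ->
  (1 - q ^+ (2 * L).+1) * odsum B chi3 L =
    q ^+ L * evsum B chi3 L + odsum B chi3 (L%:Z - 1).
Proof.
move=> LB.
have -> : evsum B chi3 L = evsum B (fun r => chi3 r + chi3 (r - 1)) L.
  rewrite -[LHS]evsumN; apply: eq_bisum => r; congr (_ * _).
  rewrite chi3N; have -> : r + 1 = r - 1 + 2 by ring.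
  by rewrite chi3D opprK addrC; congr (_ + _); congr chi3; ring.
rewrite evsumD mulrDr.
have sh : evsum B (fun r => chi3 (r - 1)) L =
    bisum B (fun r => chi3 r * (qz ((r + 1) * (r + 1)) * (e (L%:Z - r - 1) * e (L%:Z + 1 + r)))).
  rewrite /evsum -bisum_shift => [|r Br]; last by rewrite inv_qpochM0 ?mulr0//; lia.
  apply: eq_bisum => r; congr (_ * (_ * (_ * _))).
  - by congr chi3; lia.
  - by congr e; lia.
  - by congr e; lia.
rewrite sh /evsum /odsum -!bisumZl -!bisumD; apply: eq_bisum => r.
have := @inv_qpoch_pascal (L%:Z - r) (L%:Z + 1 + r).
have -> : L%:Z - r + (L%:Z + 1 + r) = (2 * L).+1 by lia.
rewrite absz_nat => /(_ isT).
have -> : L%:Z + 1 + r - 1 = L%:Z + r by lia.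
have -> : L%:Z - 1 - r = L%:Z - r - 1 by lia.
have -> : L%:Z - 1 + 1 + r = L%:Z + r by lia.
move=> h.
rewrite mulrCA [X in _ * X]mulrCA h.
have E1 : qz (r * (r + 1)) * qz (L%:Z - r) * e (L%:Z - r) =
   q ^+ L * qz (r * r) * e (L%:Z - r).
  have [k0|k0] := ltP (L%:Z - r) 0; first by rewrite inv_qpoch_lt0 // !mulr0.
  congr (_ * _); rewrite expr_abszD//; last by nia.
  rewrite -[q ^+ L]/(qz L%:Z) expr_abszD//; last by nia.
  by congr (_ ^+ _); congr absz; lia.
have E2 : qz (r * (r + 1)) * qz (L%:Z + 1 + r) * e (L%:Z + 1 + r) =
   q ^+ L * qz ((r + 1) * (r + 1)) * e (L%:Z + 1 + r).
  have [k0|k0] := ltP (L%:Z + 1 + r) 0; first by rewrite inv_qpoch_lt0 // !mulr0.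
  congr (_ * _); rewrite expr_abszD//; last by nia.
  rewrite -[q ^+ L]/(qz L%:Z) expr_abszD//; last by nia.
  by congr (_ ^+ _); congr absz; lia.
transitivity (chi3 r * (qz (r * (r + 1)) * qz (L%:Z - r) * e (L%:Z - r)) * e (L%:Z + r) +
  chi3 r * (qz (r * (r + 1)) * qz (L%:Z + 1 + r) * e (L%:Z + 1 + r)) * e (L%:Z - r - 1) +
  chi3 r * (qz (r * (r + 1)) * (e (L%:Z - r - 1) * e (L%:Z + r)))); first by ring.
rewrite E1 E2; ring.
Qed.

(** The right-hand side of [odsum_rec] collapses term by term: q^(L-r) e (L-r) + e (L-r-1) = e
    (L-r). Thus the sum of the Bailey pair is an odd sum in disguise. *)
Lemma shevsumE B (L : nat) : (L.+1 < B)%N ->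
  shevsum B chi3 L = (1 - q ^+ (2 * L).+1) * odsum B chi3 L.
Proof.
move=> LB; rewrite odsum_rec// /shevsum /evsum /odsum -bisumZl -bisumD.
apply: eq_bisum => r.
have -> : L%:Z - 1 - r = L%:Z - r - 1 by lia.
have -> : L%:Z - 1 + 1 + r = L%:Z + r by lia.
rewrite inv_qpoch_pred.
have E1 : qz (r * (r + 1)) * qz (L%:Z - r) * e (L%:Z - r) =
   q ^+ L * qz (r * r) * e (L%:Z - r).
  have [k0|k0] := ltP (L%:Z - r) 0; first by rewrite inv_qpoch_lt0 // !mulr0.
  congr (_ * _); rewrite expr_abszD//; last by nia.
  rewrite -[q ^+ L]/(qz L%:Z) expr_abszD//; last by nia.
  by congr (_ ^+ _); congr absz; lia.
have -> : q ^+ L * (chi3 r * (qz (r * r) * (e (L%:Z - r) * e (L%:Z + r)))) =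
  chi3 r * (q ^+ L * qz (r * r) * e (L%:Z - r)) * e (L%:Z + r) by ring.
rewrite -E1; ring.
Qed.

(** By [shevsumE], S K is (q;q)_{2K+1} times the odd sum at K. The even sums are eliminated between
    [odsum_rec] at L+2 and L+1 and [evsum_rec] at L+1. *)
Lemma shevsum_rec B (L : nat) : (L.+3 < B)%N ->
  let S K := qpoch q q (2 * K) * shevsum B chi3 K in
  S L.+2 = (1 + q - q ^+ (2 * L).+4) * S L.+1
           - q * (1 - q ^+ (2 * L).+3) * (1 - q ^+ (2 * L).+2) * S L.
Proof.
move=> LB S; rewrite {}/S.
rewrite !shevsumE//; try by lia.
have LB2 : (L.+2 < B)%N by lia.
have := odsum_rec LB; have := odsum_rec LB2; have := evsum_rec LB2.
have -> : L.+2%:Z - 1 = L.+1 by lia.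
have -> : L.+1%:Z - 1 = L by lia.
have -> : (2 * L.+2 = (2 * L).+4)%N by lia.
have -> : (2 * L.+1 = (2 * L).+2)%N by lia.
set y2 := odsum _ _ L.+2; set y1 := odsum _ _ L.+1; set y0 := odsum _ _ L.
set x2 := evsum _ _ L.+2; set x1 := evsum _ _ L.+1.
move=> h1 h2 h3.
rewrite h3 !qpochSr.
set P := qpoch q q _.
rewrite -!exprS.
have q4 : q ^+ (2 * L).+4 = q ^+ L.+2 * q ^+ L.+2 by rewrite -exprD; congr (_ ^+ _); lia.
have -> : P * (1 - q ^+ (2 * L).+1) * (1 - q ^+ (2 * L).+2) * (1 - q ^+ (2 * L).+3) *
 (1 - q ^+ (2 * L).+4) * (q ^+ L.+2 * x2 + y1) =
  P * (1 - q ^+ (2 * L).+1) * (1 - q ^+ (2 * L).+2) * (1 - q ^+ (2 * L).+3) *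
  (q ^+ L.+2 * ((1 - q ^+ (2 * L).+4) * x2) + (1 - q ^+ (2 * L).+4) * y1) by ring.
rewrite h1.
have -> : q ^+ L.+2 * (q ^+ L.+2 * y1 + x1) = q ^+ (2 * L).+4 * y1 + q * (q ^+ L.+1 * x1).
  by rewrite q4 [q ^+ L.+2]exprS; ring.
have -> : q ^+ L.+1 * x1 = (1 - q ^+ (2 * L).+3) * y1 - y0 by rewrite h2; ring.
by rewrite [q ^+ (2 * L).+4]exprS; ring.
Qed.

End InverseQPochhammer.

(** * Recurrence for the double sum over (m, n) *)

Lemma big_nat_shift (V : zmodType) (F : nat -> V) B j :
  (forall M, (M < j)%N -> F M = 0) -> (forall M, (B <= M)%N -> F M = 0) ->
  \sum_(0 <= M < B) F M = \sum_(0 <= M < B) F (M + j)%N.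
Proof.
move=> Fj FB; transitivity (\sum_(0 <= M < j + B) F M).
  rewrite [RHS](@big_cat_nat _ _ _ B) //=; last by lia.
  rewrite [X in _ + X]big_nat_cond [X in _ + X]big1 ?addr0// => i.
  by case/andP=> /andP[Bi _] _; exact: FB.
rewrite (@big_cat_nat _ _ _ j) //=; last by lia.
rewrite big_nat_cond big1 ?add0r => [|i /andP[/andP[_ ij] _]]; last exact: Fj.
by rewrite -{1}[j]add0n big_addn addKn.
Qed.

Lemma triS n : ('C(n.+2, 2) = n.+1 + 'C(n.+1, 2))%N.
Proof. by rewrite binS bin1 addnC. Qed.

Lemma triE2 n : (2 * 'C(n.+1, 2) = n * n.+1)%N.
Proof. by elim: n => // n IH; rewrite triS; lia. Qed.

Section DoubleSum.
Variables (C : numFieldType) (q : C).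
Hypothesis q_lt1 : `|q| < 1.
Local Notation e := (inv_qpoch q).
Local Notation qz k := (q ^+ absz k).
Local Notation tri n := 'C(n.+1, 2).

(** Coefficient of x^k in 1/(q x;q)_oo = (1 - x)/(x;q)_oo. The next lemma replaces x by q x twice,
    whence the coefficients 1, -(1 + q), q of (1 - x)(1 - q x). *)
Lemma mulqz_inv_qpoch k : qz k * e k = e k - e (k - 1).
Proof. by rewrite inv_qpoch_pred//; ring. Qed.

Lemma mulqz2_inv_qpoch k : 
  qz k * qz k * e k = e k - (1 + q) * e (k - 1) + q * e (k - 2).
Proof.
have -> : k - 2 = k - 1 - 1 by ring.
have [->|k0] := eqVneq k 0; first by rewrite /= expr0 mulr1 mul1r; ring.
rewrite -mulrA mulqz_inv_qpoch mulrBr mulqz_inv_qpoch.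
have -> : qz k * e (k - 1) = q * (qz (k - 1) * e (k - 1)).
  have [k1|k1] := ltP k 1; first by rewrite inv_qpoch_lt0 ?mulr0//; lia.
  rewrite [RHS]mulrA -exprS; congr (q ^+ _ * _); lia.
by rewrite mulqz_inv_qpoch; ring.
Qed.

(* Coefficient of y^k in 1/(y^2;q)_oo. *)
Definition even_coef (k : int) : C :=
  if (k %% 2)%Z == 0 then e (k %/ 2)%Z else 0.
Local Notation E := even_coef.

Lemma even_coef_lt0 k : k < 0 -> E k = 0.
Proof. by move=> k0; rewrite /E; case: ifP => // _; rewrite inv_qpoch_lt0//; lia. Qed.

(** Replacing y by q y multiplies 1/(y^2;q)_oo by (1 - y^2)(1 - q y^2). *)
Lemma even_coef_rec k : qz k * E k = E k - (1 + q) * E (k - 2) + q * E (k - 4).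
Proof.
rewrite /E.
have -> : ((k - 2) %% 2 = k %% 2)%Z by lia.
have -> : ((k - 4) %% 2 = k %% 2)%Z by lia.
case: ifP => h; last by ring.
have -> : ((k - 2) %/ 2)%Z = (k %/ 2)%Z - 1 by lia.
have -> : ((k - 4) %/ 2)%Z = (k %/ 2)%Z - 2 by lia.
rewrite -mulqz2_inv_qpoch -exprD.
by congr (q ^+ _ * _); lia.
Qed.

(* Coefficient of y^(3n) in (-q^3 y^3;q^3)_oo. *)
Definition cubic_coef n : C := q ^+ (3 * tri n) / qpoch (q ^+ 3) (q ^+ 3) n.
Local Notation g := cubic_coef.

Lemma qpoch3_neq0 n : qpoch (q ^+ 3) (q ^+ 3) n != 0.
Proof.
apply: qpochqq_neq0; rewrite normrX; apply: exprn_ilt1 => //.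
Qed.

(** The functional equation G(y) = (1 + q^3 y^3) G(q y) of G(y) = (-q^3 y^3;q^3)_oo. *)
Lemma cubic_coef_rec n : g n.+1 = q ^+ (3 * n.+1) * (g n.+1 + g n).
Proof.
rewrite /g triS mulnDr exprD qpochSr -exprS -exprM.
have h1 := qpoch3_neq0 n.
have h2 := subr1X_neq0 q_lt1 (isT : (0 < 3 * n.+1)%N).
by field; rewrite h1 h2.
Qed.

Section Truncation.
Variable K : nat.

(* Coefficients of y^M in (-q^3 y^3;q^3)_oo / (y^2;q)_oo for M < 3 * K. *)
Definition mixed_coef (M : int) : C :=
  \sum_(0 <= n < K) g n * E (M - (3 * n)%:Z).
Local Notation b := mixed_coef.

Lemma mixed_coef_lt0 M : M < 0 -> b M = 0.
Proof.
move=> M0; rewrite /b big1// => n _; rewrite even_coef_lt0 ?mulr0//; lia.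
Qed.

Lemma mixed_coef0 : (0 < K)%N -> b 0 = 1.
Proof.
rewrite /b; case: K => // k _; rewrite big_nat_recl// big1 ?addr0.
  by rewrite /g /E /= muln0 expr0 !qpoch0 invr1 !mulr1.
by move=> n _; rewrite even_coef_lt0 ?mulr0//; lia.
Qed.

(** For the product F of the two series: (1 + q^3 y^3) F(q y) = (1 - y^2)(1 - q y^2) F(y). The bound
    on M makes the term n = K, lost by the truncation, vanish. *)
Lemma mixed_coef_rec (M : nat) : (M < 3 * K)%N ->
  q ^+ M * (b M + b (M%:Z - 3)) = b M - (1 + q) * b (M%:Z - 2) + q * b (M%:Z - 4).
Proof.
move=> MK.
pose Psi k := E k - (1 + q) * E (k - 2) + q * E (k - 4).
have PsiE k : qz k * E k = Psi k by exact: even_coef_rec.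
have Psi0 k : k < 0 -> Psi k = 0.
  by move=> k0; rewrite -PsiE even_coef_lt0 ?mulr0.
have -> : b M - (1 + q) * b (M%:Z - 2) + q * b (M%:Z - 4) =
    \sum_(0 <= n < K) g n * Psi (M%:Z - (3 * n)%:Z).
  rewrite /b !big_distrr/= -sumrB -big_split/=; apply: eq_bigr => n _.
  rewrite /Psi.
  have -> : M%:Z - 2 - (3 * n)%:Z = M%:Z - (3 * n)%:Z - 2 by ring.
  have -> : M%:Z - 4 - (3 * n)%:Z = M%:Z - (3 * n)%:Z - 4 by ring.
  by ring.
have qPsi (n : nat) : q ^+ M * E (M%:Z - (3 * n)%:Z) =
    q ^+ (3 * n) * Psi (M%:Z - (3 * n)%:Z).
  have [n0|n0] := ltP (M%:Z - (3 * n)%:Z) 0.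
    by rewrite Psi0// even_coef_lt0 ?mulr0.
  rewrite -PsiE mulrA -exprD; congr (q ^+ _ * _); lia.
pose g' n := if n is m.+1 then g m else 0.
have -> : b (M%:Z - 3) = \sum_(0 <= n < K) g' n * E (M%:Z - (3 * n)%:Z).
  rewrite [RHS](@big_nat_shift _ _ _ 1) => [|[]// _|n Kn].
  - apply: eq_bigr => n _; rewrite addn1 /=; congr (_ * E _); lia.
  - by rewrite mul0r.
  - by rewrite even_coef_lt0 ?mulr0//; lia.
rewrite /b -big_split big_distrr/=; apply: eq_bigr => n _.
rewrite -mulrDl mulrCA qPsi mulrA; congr (_ * _).
case: n => [|n]; first by rewrite /= muln0 expr0 mulr1 addr0.
by rewrite /= [RHS]cubic_coef_rec mulrC.
Qed.

(** Coefficients of H(y) = (1 + y) F(y). The extra factor reduces the functional equation of F to (1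
    - q y + q^2 y^2) H(q y) = (1 - y)(1 - q y^2) H(y), which is [paired_coef_rec]. *)
Definition paired_coef (M : int) : C := b M + b (M - 1).
Local Notation c := paired_coef.

Lemma paired_coef_lt0 M : M < 0 -> c M = 0.
Proof. by move=> M0; rewrite /c !mixed_coef_lt0 ?addr0//; lia. Qed.

Lemma paired_coef_rec (M : nat) : (M < 3 * K)%N ->
  (1 - q ^+ M) * c M = (1 - q ^+ M) * c (M%:Z - 1) + (q + q ^+ M) * c (M%:Z - 2)
                       - q * c (M%:Z - 3).
Proof.
move=> MK; rewrite /c.
have -> : M%:Z - 1 - 1 = M%:Z - 2 by ring.
have -> : M%:Z - 2 - 1 = M%:Z - 3 by ring.
have -> : M%:Z - 3 - 1 = M%:Z - 4 by ring.
have h := mixed_coef_rec MK.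
apply/eqP; rewrite -subr_eq0; apply/eqP.
transitivity ((b M - (1 + q) * b (M%:Z - 2) + q * b (M%:Z - 4)) -
  q ^+ M * (b M + b (M%:Z - 3))); first by ring.
by rewrite h subrr.
Qed.

Definition gauss_coef (M : int) : C := q ^+ tri `|M|%N * c M.
Local Notation phi := gauss_coef.

Lemma gauss_coef_lt0 M : M < 0 -> phi M = 0.
Proof. by move=> M0; rewrite /phi paired_coef_lt0 ?mulr0. Qed.

Lemma gauss_coef_rec (M : nat) : (M < 3 * K)%N ->
  (1 - q ^+ M) * phi M = (q ^+ M - q ^+ (2 * M)) * phi (M%:Z - 1)
    + (q ^+ (2 * M) + q ^+ (3 * M - 1)) * phi (M%:Z - 2)
    - q ^+ (3 * M - 2) * phi (M%:Z - 3).
Proof.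
move=> MK.
have h := paired_coef_rec MK.
(* For M < 3 some indices M - j are negative and the subtractions in the exponents may be truncated;
   the coefficients concerned are then 0. *)
case: M MK h => [|[|[|M]]] MK h.
- by rewrite (@gauss_coef_lt0 (0%:Z - 1))// (@gauss_coef_lt0 (0%:Z - 2))// (@gauss_coef_lt0 (0%:Z - 3))//; ring.
- rewrite (@gauss_coef_lt0 (1%:Z - 2))// (@gauss_coef_lt0 (1%:Z - 3))//.
  move: h; rewrite (@paired_coef_lt0 (1%:Z - 2))// (@paired_coef_lt0 (1%:Z - 3))// /phi.
  rewrite !mulr0 !addr0 oppr0 !addr0 => h.
  have -> : tri `|1%:Z|%N = 1%N by [].
  have -> : tri `|1%:Z - 1|%N = 0%N by [].
  by rewrite mulrCA h; ring.
- rewrite !(@gauss_coef_lt0 (2%:Z - 3))//.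
  move: h; rewrite !(@paired_coef_lt0 (2%:Z - 3))// /phi.
  have -> : tri `|2%:Z|%N = 3%N by [].
  have -> : tri `|2%:Z - 1|%N = 1%N by [].
  have -> : tri `|2%:Z - 2|%N = 0%N by [].
  move=> h; rewrite mulrCA h; ring.
- rewrite /phi mulrCA h.
  have -> : M.+3%:Z - 1 = M.+2 by lia.
  have -> : M.+3%:Z - 2 = M.+1 by lia.
  have -> : M.+3%:Z - 3 = M by lia.
  rewrite !absz_nat !triS !exprD.
  have -> : (2 * M.+3 = M + M + 6)%N by lia.
  have -> : (3 * M.+3 - 1 = M + M + M + 8)%N by lia.
  have -> : (3 * M.+3 - 2 = M + M + M + 7)%N by lia.
  by rewrite !exprD !exprS; ring.
Qed.

(** The range M < 2K stays where [mixed_coef] is exact, and its even elements M = 2m correspond to m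
    < K. *)
Definition transform (L : int) : C := \sum_(0 <= M < 2 * K) phi M * e (L - M%:Z).
Local Notation T := transform.

(** [gauss_coef_rec] is summed against D k = q^(2k) e k with k = L - M. The factor q^(2k) turns
    q^(2M) into q^(2L), and q^M into q^L q^k, where q^k e k = e k - e (k-1); so M disappears from
    the coefficients. *)
Lemma transform_rec (L : nat) : (0 < L < 2 * K)%N ->
  (1 - q ^+ L) * T L = (1 + q - q ^+ (2 * L)) * T (L%:Z - 1)
    - (q + q ^+ L) * (1 - q ^+ (2 * L - 1)) * T (L%:Z - 2).
Proof.
move=> /andP[L0 LK].
pose D k := e k - (1 + q) * e (k - 1) + q * e (k - 2).
have DE k : qz k * qz k * e k = D k by exact: mulqz2_inv_qpoch.
have D0 k : k < 0 -> D k = 0 by move=> k0; rewrite -DE inv_qpoch_lt0 ?mulr0.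
have shift u j : \sum_(0 <= M < 2 * K) u M * phi (M%:Z - j%:Z) * D (L%:Z - M%:Z) =
    \sum_(0 <= M < 2 * K) u (M + j)%N * phi M * D (L%:Z - M%:Z - j%:Z).
  rewrite (@big_nat_shift _ _ _ j) => [|M Mj|M KM].
  - apply: eq_bigr => M _; congr (_ * phi _ * D _); lia.
  - by rewrite gauss_coef_lt0 ?mulr0 ?mul0r//; lia.
  - by rewrite D0 ?mulr0//; lia.
have : \sum_(0 <= M < 2 * K) (1 - q ^+ M) * phi M * D (L%:Z - M%:Z)
  - \sum_(0 <= M < 2 * K) (q ^+ M - q ^+ (2 * M)) * phi (M%:Z - 1%:Z) * D (L%:Z - M%:Z)
  - \sum_(0 <= M < 2 * K) (q ^+ (2 * M) + q ^+ (3 * M - 1)) * phi (M%:Z - 2%:Z) * D (L%:Z - M%:Z)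
  + \sum_(0 <= M < 2 * K) q ^+ (3 * M - 2) * phi (M%:Z - 3%:Z) * D (L%:Z - M%:Z) = 0.
  rewrite -!sumrB -big_split/= big_nat_cond big1// => M /andP[/andP[_ MK] _].
  by rewrite gauss_coef_rec ?leq_trans ?MK//; [ring|lia].
rewrite !shift -!sumrB -big_split/= => h.
apply/eqP; rewrite -subr_eq0; apply/eqP; rewrite -[RHS]h.
rewrite /T !big_distrr/= -!sumrB; apply: eq_bigr => M _.
have -> : L%:Z - 1 - M%:Z = L%:Z - M%:Z - 1 by ring.
have -> : L%:Z - 2 - M%:Z = L%:Z - M%:Z - 2 by ring.
set k := L%:Z - M%:Z.
have kL : L%:Z = M%:Z + k by rewrite /k; lia.
have e1 : q ^+ M * D k = q ^+ L * (e k - e (k - 1)).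
  have [k0|k0] := ltP k 0; first by rewrite D0 ?inv_qpoch_lt0 ?subrr ?mulr0//; lia.
  rewrite -mulqz_inv_qpoch -DE !mulrA -!exprD; congr (q ^+ _ * _); lia.
have e2 : q ^+ (M + 1) * D (k - 1) = q ^+ L * (e (k - 1) - e (k - 2)).
  have [k0|k0] := ltP k 1; first by rewrite D0 ?inv_qpoch_lt0 ?subrr ?mulr0//; lia.
  have -> : k - 2 = k - 1 - 1 by ring.
  rewrite -mulqz_inv_qpoch -DE !mulrA -!exprD; congr (q ^+ _ * _); lia.
have e3 : q ^+ (2 * (M + 1)) * D (k - 1) = q ^+ (2 * L) * e (k - 1).
  have [k0|k0] := ltP k 1; first by rewrite D0 ?inv_qpoch_lt0 ?subrr ?mulr0//; lia.
  rewrite -DE !mulrA -!exprD; congr (q ^+ _ * _); lia.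
have e4 : q ^+ (2 * (M + 2)) * D (k - 2) = q ^+ (2 * L) * e (k - 2).
  have [k0|k0] := ltP k 2; first by rewrite D0 ?inv_qpoch_lt0 ?subrr ?mulr0//; lia.
  rewrite -DE !mulrA -!exprD; congr (q ^+ _ * _); lia.
(* Each cubic term alone keeps a factor q^M. Their difference contains e (k-2) - e (k-3) = q^(k-2) e
   (k-2), which completes q^M to q^(L-2). *)
have e5 : q ^+ (3 * (M + 2) - 1) * D (k - 2) - q ^+ (3 * (M + 3) - 2) * D (k - 3)
    = q ^+ L * q ^+ (2 * L - 1) * e (k - 2).
  have [k0|k0] := ltP k 2.
    rewrite !D0 ?inv_qpoch_lt0 ?subrr ?mulr0 ?subrr//; lia.
  have -> : q ^+ (3 * (M + 2) - 1) * D (k - 2) = q ^+ (2 * L + M + 1) * e (k - 2).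
    rewrite -DE !mulrA -!exprD; congr (q ^+ _ * _); lia.
  have -> : q ^+ (3 * (M + 3) - 2) * D (k - 3) = q ^+ (2 * L + M + 1) * e (k - 3).
    have [k3|k3] := ltP k 3; first by rewrite D0 ?inv_qpoch_lt0 ?subrr ?mulr0//; lia.
    rewrite -DE !mulrA -!exprD; congr (q ^+ _ * _); lia.
  have -> : k - 3 = k - 2 - 1 by ring.
  rewrite -mulrBr -mulqz_inv_qpoch !mulrA -!exprD; congr (q ^+ _ * _); lia.
transitivity (phi M * (D k - q ^+ M * D k - q ^+ (M + 1) * D (k - 1) +
   q ^+ (2 * (M + 1)) * D (k - 1) - q ^+ (2 * (M + 2)) * D (k - 2) -
   (q ^+ (3 * (M + 2) - 1) * D (k - 2) - q ^+ (3 * (M + 3) - 2) * D (k - 3)))); last by ring.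
rewrite e1 e2 e3 e4 e5 /D.
have -> : q ^+ (2 * L) = q * q ^+ (2 * L - 1) by rewrite -exprS; congr (_ ^+ _); lia.
by ring.
Qed.

End Truncation.

End DoubleSum.

(** * The Bailey pair and Bailey's lemma *)

Section DoubleSumBailey.
Variables (C : numFieldType) (q : C).
Hypothesis q_lt1 : `|q| < 1.
Local Notation e := (inv_qpoch q).
Local Notation qz k := (q ^+ absz k).
Local Notation tri n := 'C(n.+1, 2).

Lemma sum_even_coef (K : nat) (F : nat -> C) :
  \sum_(0 <= M < 2 * K) F M * even_coef q M%:Z =
  \sum_(0 <= m < K) F (2 * m)%N * e m%:Z.
Proof.
elim: K => [|K IH]; first by rewrite !big_nil.
have -> : (2 * K.+1 = (2 * K).+2)%N by lia.
rewrite big_nat_recr// big_nat_recr//= IH [RHS]big_nat_recr//= -addrA; congr (_ + _).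
have -> : even_coef q (2 * K)%:Z = e K%:Z.
  rewrite /even_coef.
  have -> : (((2 * K)%:Z %% 2)%Z == 0) = true by lia.
  by congr e; lia.
have -> : even_coef q (2 * K).+1%:Z = 0.
  rewrite /even_coef.
  by have -> : (((2 * K).+1%:Z %% 2)%Z == 0) = false by lia.
by rewrite mulr0 addr0.
Qed.

Lemma sum_mixed_coef (K : nat) (H : nat -> C) :
  (forall M, (2 * K <= M)%N -> H M = 0) ->
  \sum_(0 <= M < 2 * K) H M * mixed_coef q K M%:Z =
  \sum_(0 <= n < K) \sum_(0 <= m < K)
     cubic_coef q n * H (2 * m + 3 * n)%N * e m%:Z.
Proof.
move=> H0; rewrite /mixed_coef.
under eq_bigr do rewrite big_distrr/=.
rewrite exchange_big/=; apply: eq_bigr => n _.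
rewrite (@big_nat_shift _ _ _ (3 * n)) => [|M Mn|M KM]; last 2 first.
- by rewrite even_coef_lt0 ?mulr0//; lia.
- by rewrite H0// mul0r.
rewrite -(@sum_even_coef K (fun M => cubic_coef q n * H (M + 3 * n)%N)).
apply: eq_bigr => M _; rewrite mulrCA mulrA; congr (_ * _); congr even_coef; lia.
Qed.

(** With M = 2m + 3n in the first sum and M = 2m + 3n + 1 in the second, where the prefactor q is
    absorbed, the quadratic exponent is M(M+1)/2 + 3n(n+1)/2. *)
Lemma transformE (K L : nat) : (L < K)%N ->
  transform q K L =
   \sum_(0 <= m < K) \sum_(0 <= n < K)
      q ^+ (2 * m ^ 2 + 6 * m * n + 6 * n ^ 2 + m + 3 * n)
      * e (L%:Z - (3 * n)%:Z - (2 * m)%:Z)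
      / (qpoch q q m * qpoch (q ^+ 3) (q ^+ 3) n) +
   q * \sum_(0 <= m < K) \sum_(0 <= n < K)
      q ^+ (2 * m ^ 2 + 6 * m * n + 6 * n ^ 2 + 3 * m + 6 * n)
      * e (L%:Z - (3 * n)%:Z - (2 * m)%:Z - 1)
      / (qpoch q q m * qpoch (q ^+ 3) (q ^+ 3) n).
Proof.
move=> LK; rewrite /transform.
have -> : \sum_(0 <= M < 2 * K) gauss_coef q K M%:Z * e (L%:Z - M%:Z) =
  \sum_(0 <= M < 2 * K) (q ^+ tri M * e (L%:Z - M%:Z)) * mixed_coef q K M%:Z +
  \sum_(0 <= M < 2 * K) (q ^+ tri M * e (L%:Z - M%:Z)) * mixed_coef q K (M%:Z - 1).
  rewrite -big_split/=; apply: eq_bigr => M _.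
  by rewrite /gauss_coef /paired_coef absz_nat; ring.
congr (_ + _).
  rewrite sum_mixed_coef => [|M KM]; last by rewrite inv_qpoch_lt0 ?mulr0//; lia.
  rewrite exchange_big/=; apply: eq_bigr => m _; apply: eq_bigr => n _.
  rewrite /cubic_coef ?inv_qpochE.
  have -> : L%:Z - (2 * m + 3 * n)%:Z = L%:Z - (3 * n)%:Z - (2 * m)%:Z by lia.
  have -> : (2 * m ^ 2 + 6 * m * n + 6 * n ^ 2 + m + 3 * n =
     3 * tri n + tri (2 * m + 3 * n))%N.
    by have := triE2 n; have := triE2 (2 * m + 3 * n); nia.
  by rewrite exprD invfM; ring.
rewrite (@big_nat_shift _ _ _ 1) => [|M M1|M KM]; last 2 first.
- by rewrite mixed_coef_lt0 ?mulr0//; lia.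
- by rewrite inv_qpoch_lt0 ?mulr0 ?mul0r//; lia.
transitivity (\sum_(0 <= M < 2 * K) (q ^+ tri (M + 1) * e (L%:Z - (M + 1)%:Z)) *
    mixed_coef q K M%:Z).
  by apply: eq_bigr => M _; congr (_ * mixed_coef _ _ _); lia.
rewrite (@sum_mixed_coef K (fun M => q ^+ tri (M + 1) * e (L%:Z - (M + 1)%:Z))) => [|M KM];
  last by rewrite inv_qpoch_lt0 ?mulr0//; lia.
rewrite exchange_big big_distrr/=; apply: eq_bigr => m _.
rewrite big_distrr/=; apply: eq_bigr => n _.
rewrite /cubic_coef ?inv_qpochE.
have -> : L%:Z - (2 * m + 3 * n + 1)%:Z = L%:Z - (3 * n)%:Z - (2 * m)%:Z - 1 by lia.
rewrite [RHS]mulrA [X in _ = X / _]mulrA -exprS.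
have -> : (2 * m ^ 2 + 6 * m * n + 6 * n ^ 2 + 3 * m + 6 * n).+1 =
   (3 * tri n + tri (2 * m + 3 * n + 1))%N.
  by have := triE2 n; have := triE2 (2 * m + 3 * n + 1); nia.
by rewrite exprD invfM; ring.
Qed.

Lemma transform_lt0 (K : nat) L : L < 0 -> transform q K L = 0.
Proof.
by move=> L0; rewrite /transform big1// => M _; rewrite inv_qpoch_lt0 ?mulr0//; lia.
Qed.

Lemma transform0 K : (0 < K)%N -> transform q K 0 = 1.
Proof.
case: K => // K _; rewrite /transform.
have -> : (2 * K.+1 = (2 * K).+2)%N by lia.
rewrite big_nat_recl// big1 ?addr0 => [|i _]; last by rewrite inv_qpoch_lt0 ?mulr0//; lia.
rewrite /gauss_coef /paired_coef mixed_coef0// mixed_coef_lt0//.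
by rewrite /inv_qpoch /= qpoch0 invr1 expr0 addr0 !mulr1.
Qed.

(** Both sides satisfy the recurrence of [shevsum_rec], which has order two, so the values 1 at L =
    0 and 1 + q - q^2 at L = 1 decide. *)
Lemma transform_bailey (K B L : nat) : (L < K)%N -> (L.+1 < B)%N ->
  qpoch q q L * transform q K L = qpoch q q (2 * L) * shevsum q B (@chi3 C) L.
Proof.
elim/ltn_ind: L => L IH LK LB.
case: L IH LK LB => [|[|L]] IH LK LB.
- rewrite transform0// qpoch0 mulr1 mul1r.
  rewrite /shevsum (@bisum_widen _ 0)// => [|r r0]; last first.
    by rewrite [_ * e _]inv_qpochM0 ?mulr0//; lia.
  by rewrite /bisum big_nat1 /chi3 /= ?qpoch0 invr1 ?expr0 !(mulr1, mul1r).
- have := @transform_rec _ _ q_lt1 K 1.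
  rewrite (@transform_lt0 _ (1%:Z - 2))// transform0; last by lia.
  have -> : (0 < 1 < 2 * K)%N by lia.
  move=> /(_ isT); rewrite mulr0 subr0 mulr1 !expr1 => h.
  rewrite qpochSr qpoch0 mul1r expr0 mulr1 h.
  rewrite /shevsum (@bisum_widen _ 1) => [|//|r r0]; first last.
    by rewrite [_ * e _]inv_qpochM0 ?mulr0//; lia.
  - lia.
  rewrite bisumS /bisum big_nat1 !subrr.
  have -> : chi3 C (- 1%:Z) = 0 by [].
  have -> : chi3 C 0 = 1 by [].
  have -> : chi3 C 1 = -1 by [].
  rewrite ?subr0 ?addr0.
  have -> : 1%:Z + 1%:Z = 2%:Z by [].
  have -> : e 0 = 1 by rewrite /= qpoch0 invr1.
  rewrite ?mul0r ?[qz 0]expr0.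
  have -> : qz (1 * 2%:Z) = q * q by rewrite -expr2.
  have -> : (2 * 1 = 2)%N by [].
  rewrite !inv_qpochE !qpochSr qpoch0 expr0 expr1 mulr1 mul1r.
  have h1 := subr1X_neq0 q_lt1 (isT : (0 < 1)%N).
  have h2 := subr1X_neq0 q_lt1 (isT : (0 < 2)%N).
  rewrite expr1 in h1; rewrite expr2 in h2.
  by field; rewrite h1 h2.
have h := @transform_rec _ _ q_lt1 K L.+2.
have {}h := h ltac:(lia).
have := @shevsum_rec _ _ q_lt1 B L LB; rewrite /=.
rewrite -(IH L.+1)//; try lia.
rewrite -(IH L)//; try lia.
move=> ->.
rewrite (qpochSr _ _ L.+1) (qpochSr _ _ L) -!exprS -mulrA h.
have -> : L.+2%:Z - 1 = L.+1 by lia.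
have -> : L.+2%:Z - 2 = L by lia.
have -> : (2 * L.+2 = (2 * L).+4)%N by lia.
have -> : ((2 * L).+4 - 1 = (2 * L).+3)%N by lia.
(* Exposes 1 - q^(2L+2) = (1 - q^(L+1))(1 + q^(L+1)): the first factor comes from (q;q)_{L+1}, the
   second from q + q^(L+2) in [transform_rec]. *)
have -> : q ^+ (2 * L).+2 = q ^+ L.+1 * q ^+ L.+1 by rewrite -exprD; congr (_ ^+ _); lia.
by rewrite [q ^+ L.+2]exprS; ring.
Qed.

(** The q-Chu-Vandermonde sum. Writing 1 - q^(n+1) = (1 - q^(n+1-k)) + q^(n+1-k) (1 - q^k) reduces n
    + 1 to the cases (n, a) and (n, a + 1), so the induction must hold for all a. *)
Lemma q_vandermonde (n a : nat) :
  \sum_(0 <= k < n.+1) q ^+ (k * k + a * k) * (e (n%:Z - k%:Z) * e k%:Z * e (k + a)%:Z)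
  = e n%:Z * e (n + a)%:Z.
Proof.
elim: n a => [|n IH] a.
  rewrite big_nat1 !muln0 expr0 mul1r subrr add0n.
  by rewrite /= qpoch0 invr1 !mul1r.
have n0 := subr1X_neq0 q_lt1 (isT : (0 < n.+1)%N).
apply: (mulfI n0); rewrite big_distrr/=.
have step k : (0 <= k < n.+2)%N ->
  (1 - q ^+ n.+1) * (q ^+ (k * k + a * k) * (e (n.+1%:Z - k%:Z) * e k%:Z * e (k + a)%:Z)) =
  q ^+ (k * k + a * k) * (e (n%:Z - k%:Z) * e k%:Z * e (k + a)%:Z) +
  q ^+ (k * k + a * k + (n.+1 - k)) * (e (n.+1%:Z - k%:Z) * e (k%:Z - 1) * e (k + a)%:Z).
  move=> /andP[_ kn].
  have -> : n%:Z - k%:Z = n.+1%:Z - k%:Z - 1 by lia.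
  rewrite !inv_qpoch_pred// !exprD.
  have -> : absz (n.+1%:Z - k%:Z) = (n.+1 - k)%N by lia.
  have -> : q ^+ n.+1 = q ^+ (n.+1 - k) * q ^+ k by rewrite -exprD; congr (_ ^+ _); lia.
  by rewrite absz_nat; ring.
rewrite (eq_big_nat _ _ step) big_split/=.
rewrite big_nat_recr//= [e (n%:Z - n.+1%:Z)]inv_qpoch_lt0 ?mul0r ?mulr0 ?addr0; last by lia.
rewrite IH.
have -> : \sum_(0 <= k < n.+2) q ^+ (k * k + a * k + (n.+1 - k)) *
    (e (n.+1%:Z - k%:Z) * e (k%:Z - 1) * e (k + a)%:Z) =
  q ^+ (n + a.+1) * (e n%:Z * e (n + a.+1)%:Z).
  rewrite big_nat_recl// [e (0%:Z - 1)]inv_qpoch_lt0// mulr0 mul0r mulr0 add0r.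
  rewrite -IH big_distrr; apply: eq_big_nat => k kn; cbv beta.
  rewrite [RHS]mulrA -exprD.
  have -> : n.+1%:Z - k.+1%:Z = n%:Z - k%:Z by lia.
  have -> : k.+1%:Z - 1 = k by lia.
  have -> : (k.+1 + a = k + a.+1)%N by lia.
  by congr (q ^+ _ * _); nia.
have -> : e (n + a)%:Z = (1 - q ^+ (n + a.+1)) * e (n + a.+1)%:Z.
  have -> : (n + a)%:Z = (n + a.+1)%:Z - 1 by lia.
  by rewrite inv_qpoch_pred.
have -> : e n%:Z = (1 - q ^+ n.+1) * e n.+1%:Z.
  have -> : n%:Z = n.+1%:Z - 1 by lia.
  by rewrite inv_qpoch_pred.
have -> : (n.+1 + a = n + a.+1)%N by lia.
by rewrite -!inv_qpochE; ring.
Qed.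

(** [alpha] is kept bilateral: for s > 0 the usual one-sided entry of a Bailey pair relative to 1 is
    alpha s + alpha (-s). *)
Definition bailey B (alpha : int -> C) (N : nat) : C :=
  bisum B (fun s => alpha s * (e (N%:Z - s) * e (N%:Z + s))).

(** Bailey's lemma with both parameters sent to infinity, for a single s. By symmetry s = a >= 0,
    and r = a + k turns the sum into [q_vandermonde] for N - a and 2a. *)
Lemma bailey_step_term (N : nat) (s : int) :
  \sum_(0 <= r < N.+1) q ^+ (r ^ 2) * e (N%:Z - r%:Z) * (e (r%:Z - s) * e (r%:Z + s)) =
  qz (s * s) * (e (N%:Z - s) * e (N%:Z + s)).
Proof.
wlog [a ->] : s / exists a : nat, s = a%:Z.
  move=> H; have [s0|s0] := leP 0 s; first by apply: H; exists (absz s); lia.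
  have := H (- s) ltac:(by exists (absz s); lia).
  rewrite !opprK mulrNN [e (N%:Z + s) * _]mulrC => <-.
  by apply: eq_bigr => r _; rewrite [e (r%:Z - s) * _]mulrC.
have [Na|aN] := ltnP N a.
  rewrite inv_qpochM0 ?mulr0; last by lia.
  rewrite big_nat_cond big1// => r /andP[/andP[_ rN] _].
  by rewrite inv_qpochM0 ?mulr0//; lia.
rewrite (@big_cat_nat _ _ _ a)//; last by lia.
rewrite big_nat_cond big1 ?add0r => [|r /andP[/andP[_ rN] _]]; last first.
  by rewrite inv_qpochM0 ?mulr0//; lia.
rewrite -{1}[a]add0n big_addn subSn//.
have := q_vandermonde (N - a) (2 * a).
have -> : e (N - a)%:Z * e (N - a + 2 * a)%:Z = e (N%:Z - a%:Z) * e (N%:Z + a%:Z).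
  by congr (e _ * e _); lia.
move=> <-; rewrite [LHS]add0r big_distrr; apply: eq_big_nat => k _; cbv beta.
have -> : absz (a%:Z * a%:Z) = (a * a)%N by lia.
have -> : ((k + a) ^ 2 = a * a + (k * k + 2 * a * k))%N by nia.
have -> : N%:Z - (k + a)%:Z = (N - a)%:Z - k%:Z by lia.
have -> : (k + a)%:Z - a%:Z = k by lia.
have -> : (k + a)%:Z + a%:Z = (k + 2 * a)%:Z by lia.
by rewrite exprD /=; ring.
Qed.

Lemma bailey_step B alpha (N : nat) :
  \sum_(0 <= r < N.+1) q ^+ (r ^ 2) * e (N%:Z - r%:Z) * bailey B alpha r =
  bailey B (fun s => qz (s * s) * alpha s) N.
Proof.
rewrite /bailey /bisum.
under eq_bigr do rewrite big_distrr/=.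
rewrite exchange_big/=; apply: eq_bigr => i _.
set s := i%:Z - _.
rewrite mulrAC -bailey_step_term mulrC big_distrr/=.
by apply: eq_bigr => r _; ring.
Qed.

Lemma bailey_widen A B alpha (N : nat) : (N <= A)%N -> (N <= B)%N ->
  bailey A alpha N = bailey B alpha N.
Proof.
move=> NA NB; transitivity (bailey N alpha N).
  apply: bisum_widen => // r rN; rewrite inv_qpochM0 ?mulr0//; lia.
symmetry; apply: bisum_widen => // r rN; rewrite inv_qpochM0 ?mulr0//; lia.
Qed.

End DoubleSumBailey.

(* Absolutely bounded families and dominated convergence *)
#[local] Existing Instance totally_filter.

Section AbsoluteSums.
Variable C : numFieldType.
Implicit Types (I J : choiceType).

Definition abs_bounded I (x : I -> C) : Prop :=
  exists M, forall s : seq I, uniq s -> \sum_(i <- s) `|x i| <= M.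

(** The form of completeness assumed of the abstract field; it is established for R[i] in
    [complex_abs_complete]. *)
Definition abs_complete : Prop :=
  forall I (x : I -> C), abs_bounded x -> is_summable x.

Lemma partial_sumE I (V : zmodType) (x : I -> V) (A : {fset I}) :
  partial_sum x A = \sum_(i <- A) x i.
Proof. by rewrite /partial_sum big_seq_fsetE. Qed.

Lemma totally_cvgP I (x : I -> C) (l : C) :
  (partial_sum x @ totally --> l) <->
  (forall eps : C, 0 < eps -> exists A : {fset I}, forall B : {fset I},
     (A `<=` B)%fset -> `|l - \sum_(i <- B) x i| < eps).
Proof.
split=> [/cvgrPdist_lt h eps eps0|h].
  have [A _ hA] := h _ eps0; exists A => B AB.
  by have := hA B AB; rewrite /= partial_sumE.
apply/cvgrPdist_lt => eps eps0; have [A hA] := h _ eps0.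
by exists A => // B AB; rewrite /= partial_sumE; apply: hA.
Qed.

Lemma abs_bounded_le I (x y : I -> C) (c : C) : 0 <= c ->
  (forall i, `|x i| <= c * `|y i|) -> abs_bounded y -> abs_bounded x.
Proof.
move=> c0 xy [M hM]; exists (c * M) => s us.
apply: (@le_trans _ _ (\sum_(i <- s) c * `|y i|)); first exact: ler_sum.
by rewrite -mulr_sumr ler_wpM2l ?hM.
Qed.

Lemma abs_bounded_inj I J (h : J -> I) (x : I -> C) : injective h ->
  abs_bounded x -> abs_bounded (x \o h).
Proof.
move=> hinj [M hM]; exists M => s us.
by rewrite -(big_map h predT (fun i => `|x i|)) hM// map_inj_uniq.
Qed.

Lemma ler_sum_sub I (F : I -> C) (s t : seq I) : (forall i, 0 <= F i) ->
  uniq s -> uniq t -> {subset s <= t} -> \sum_(i <- s) F i <= \sum_(i <- t) F i.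
Proof.
move=> F0 us ut st.
have <- : \sum_(i <- [seq i <- t | i \in s]) F i = \sum_(i <- s) F i.
  apply: perm_big; apply: uniq_perm => //; first exact: filter_uniq.
  by move=> i; rewrite mem_filter; apply: andb_idr => /st.
by rewrite big_filter big_mkcond/=; apply: ler_sum => i _; case: ifP.
Qed.

Lemma abs_bounded_prod I J (x : I -> C) (y : J -> C) :
  abs_bounded x -> abs_bounded y ->
  abs_bounded (fun p : I * J => x p.1 * y p.2).
Proof.
move=> [M hM] [N hN]; exists (M * N) => s us.
set s1 := undup [seq p.1 | p <- s]; set s2 := undup [seq p.2 | p <- s].
apply: (@le_trans _ _ (\sum_(p <- [seq (i, j) | i <- s1, j <- s2]) `|x p.1 * y p.2|)).
  apply: ler_sum_sub => //.
    apply: allpairs_uniq; rewrite ?undup_uniq//.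
    by move=> [? ?] [? ?] _ _ /= ->.
  move=> [i j] ps; apply/allpairsP; exists (i, j); split => //.
    by rewrite mem_undup; apply/mapP; exists (i, j).
  by rewrite mem_undup; apply/mapP; exists (i, j).
rewrite big_allpairs_dep/=.
have -> : \sum_(i <- s1) \sum_(j <- s2) `|x i * y j| =
    (\sum_(i <- s1) `|x i|) * (\sum_(j <- s2) `|y j|).
  rewrite big_distrl/=; apply: eq_bigr => i _; rewrite big_distrr/=.
  by apply: eq_bigr => j _; rewrite normrM.
by apply: ler_pM; rewrite ?sumr_ge0 ?hM ?hN// undup_uniq.
Qed.

Lemma abs_bounded_geometric (r : C) : `|r| < 1 -> abs_bounded (fun n : nat => r ^+ n).
Proof.
move=> r1; have r1' : 0 < 1 - `|r| by rewrite subr_gt0.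
exists ((1 - `|r|)^-1) => s us.
set K := (\max_(i <- s) i).+1.
apply: (@le_trans _ _ (\sum_(i <- iota 0 K) `|r ^+ i|)).
  apply: ler_sum_sub; rewrite ?iota_uniq// => i si.
  by rewrite mem_iota /= add0n ltnS; apply: leq_bigmax_seq.
rewrite -[K in iota _ K]subn0 -/(index_iota 0 K).
have -> : \sum_(0 <= i < K) `|r ^+ i| = (1 - `|r| ^+ K) / (1 - `|r|).
  elim: K => [|K IH]; first by rewrite big_nil expr0 subrr mul0r.
  rewrite big_nat_recr//= IH normrX exprS.
  by field; rewrite gt_eqF.
apply: ler_piMl; first by rewrite invr_ge0 ltW.
by rewrite lerBlDr lerDl exprn_ge0.
Qed.

Lemma abs_bounded_bool (x : bool -> C) : abs_bounded x.
Proof.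
exists (`|x true| + `|x false|) => s us.
apply: (@le_trans _ _ (\sum_(i <- [:: true; false]) `|x i|)).
  by apply: ler_sum_sub => //; case; rewrite !inE.
by rewrite !big_cons big_nil addr0.
Qed.

Lemma abs_bounded_geometric_int (r : C) : `|r| < 1 ->
  abs_bounded (fun k : int => r ^+ absz k).
Proof.
move=> r1.
have := abs_bounded_inj _ (abs_bounded_prod (abs_bounded_bool (fun=> 1))
  (abs_bounded_geometric r1)) (h := fun k : int => (k < 0, absz k)).
move=> /(_ _)[|M hM]; first by move=> a b [h1 h2]; lia.
by exists M => s /hM; rewrite (eq_bigr (fun k : int => `|r ^+ absz k|))// => i _; rewrite /= mul1r.
Qed.

Hypothesis Ccomplete : abs_complete.

Lemma multisum_cvg I (x : I -> C) : abs_bounded x ->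
  partial_sum x @ totally --> multisum x.
Proof. by move=> /Ccomplete. Qed.

Lemma abs_bounded_norm I (x : I -> C) : abs_bounded x -> abs_bounded (fun i => `|x i|).
Proof. by move=> [M hM]; exists M => s us; under eq_bigr do rewrite normr_id; exact: hM. Qed.

(** The norms form a summable family, so the finite sums over A and over A together with s are both
    within eps / 2 of its sum; their difference is the sum over s. *)
Lemma abs_bounded_tail I (x : I -> C) (eps : C) : abs_bounded x -> 0 < eps ->
  exists A : {fset I}, forall s : seq I, uniq s -> (forall i, i \in s -> i \notin A) ->
    \sum_(i <- s) `|x i| < eps.
Proof.
move=> bx eps0.
have /totally_cvgP/(_ (eps / 2)) := multisum_cvg (abs_bounded_norm bx).
case=> [|A hA]; first by rewrite divr_gt0.
exists A => s us sA.
have := hA (A `|` [fset i in s])%fset (fsubsetUl _ _).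
have := hA A (fsubset_refl _).
set S := multisum _ => h1 h2.
have -> : \sum_(i <- s) `|x i| = \sum_(i <- (A `|` [fset i in s])%fset) `|x i| - \sum_(i <- A) `|x i|.
  apply/eqP; rewrite eq_sym subr_eq addrC -big_cat; apply/eqP.
  apply: perm_big; apply: uniq_perm => //.
    rewrite cat_uniq us fset_uniq !andbT/=.
    by apply/hasPn => i /sA.
  by move=> i; rewrite mem_cat !inE.
have n0 : 0 <= \sum_(i <- (A `|` [fset i in s])%fset) `|x i| - \sum_(i <- A) `|x i|.
  rewrite subr_ge0; apply: ler_sum_sub => // i iA; by rewrite inE iA.
rewrite -(ger0_norm n0).
set a := \sum_(i <- A) _; set b := \sum_(i <- _) _.
have -> : b - a = (S - a) - (S - b) by ring.
rewrite (le_lt_trans (ler_normB _ _))//.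
by rewrite [eps]splitr ltrD.
Qed.

Lemma multisum_sub_le I (x : I -> C) (A : {fset I}) (eps : C) : abs_bounded x ->
  (forall s : seq I, uniq s -> (forall i, i \in s -> i \notin A) ->
    \sum_(i <- s) `|x i| < eps) ->
  `|multisum x - \sum_(i <- A) x i| < eps + eps.
Proof.
move=> bx hA.
have eps0 : 0 < eps by have := hA [::] isT; rewrite big_nil; apply.
have /totally_cvgP/(_ _ eps0)[B hB] := multisum_cvg bx.
have h1 := hB (A `|` B)%fset (fsubsetUr _ _).
have -> : multisum x - \sum_(i <- A) x i = (multisum x - \sum_(i <- (A `|` B)%fset) x i) +
   \sum_(i <- (B `\` A)%fset) x i.
  have -> : \sum_(i <- (A `|` B)%fset) x i = \sum_(i <- A) x i + \sum_(i <- (B `\` A)%fset) x i.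
    rewrite -big_cat; apply: perm_big; apply: uniq_perm => //.
      rewrite cat_uniq !fset_uniq andbT/=.
      by apply/hasPn => i; rewrite !inE => /andP[].
    by move=> i; rewrite mem_cat !inE; case: (i \in A).
  by ring.
rewrite (le_lt_trans (ler_normD _ _))// ltrD//.
rewrite (le_lt_trans (ler_norm_sum _ _ _))//.
by apply: hA => // i; rewrite inE => /andP[].
Qed.

(** Dominated convergence: on a large finite A the weights converge, and off A the tail of [x]
    together with the uniform bound on [w] controls the rest. *)
Lemma tannery I (x : I -> C) (w : nat -> I -> C) (E : nat -> seq I) (B l : C) :
  abs_bounded x -> (forall K i, `|w K i| <= B) ->
  (forall i, w^~ i @ \oo --> l) ->
  (forall K, uniq (E K)) -> (forall K i, i \notin E K -> w K i = 0) ->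
  (fun K => \sum_(i <- E K) x i * w K i) @ \oo --> multisum x * l.
Proof.
move=> bx wB wl uE wE; apply/cvgrPdist_lt => eps eps0.
have B0 (i : I) : 0 <= B by exact: le_trans (wB 0%N i).
(* With d = eps / (2 D), the errors 2 d |l| and d B and a spare d add up to eps / 2; the summand 1
   makes D positive. *)
set D := B + 2 * `|l| + 1.
(* For an empty index type the bound on the weights is vacuous and does not even give 0 <= B. *)
have [/[dup] i0 _|noI] := pselect (exists i : I, True); last first.
  have E0 K : E K = [::] by case: (E K) => // i s; case: noI; exists i.
  have -> : multisum x = 0.
    apply: cvg_lim => //.
    apply/totally_cvgP => e e0; exists fset0 => A _.
    by rewrite big_seq big1 ?subrr ?normr0// => i; case: noI; exists i.
  by exists 0%N => // K _ /=; rewrite E0 big_nil mul0r subrr normr0.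
case: i0 => i0 _.
have D0 : 0 < D by rewrite /D ltr_wpDl// addr_ge0 ?(B0 i0)// mulr_ge0.
have [A hA] := abs_bounded_tail bx (divr_gt0 eps0 (mulr_gt0 (ltr0n C 2) D0)).
set d := eps / (2 * D) in hA.
have d0 : 0 < d by rewrite /d divr_gt0// mulr_gt0.
have cA : (fun K => \sum_(i <- A) x i * w K i) @ \oo --> \sum_(i <- A) x i * l.
  elim: (enum_fset A) => [|i s IH].
    by under eq_fun do rewrite big_nil; rewrite big_nil; exact: cvg_cst.
  under eq_fun do rewrite big_cons; rewrite big_cons.
  by apply: cvgD IH; apply: cvgM; [exact: cvg_cst|exact: wl].
have /cvgrPdist_lt/(_ (eps / 2)) := cA.
move=> /(_ _)[|N _ hN]; first by rewrite divr_gt0.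
exists N => // K NK; have {hN} := hN K NK; rewrite /= => hN.
have -> : \sum_(i <- E K) x i * w K i = \sum_(i <- A) x i * w K i +
    \sum_(i <- [seq i <- E K | i \notin A]) x i * w K i.
  rewrite (bigID (mem A))/= [X in _ = _ + X]big_filter; congr (_ + _).
  rewrite [RHS](bigID (mem (E K)))/= [X in _ = _ + X]big1 ?addr0 => [|i]; last first.
    by move=> iE; rewrite wE ?mulr0.
  rewrite -[LHS]big_filter -[RHS]big_filter; apply: perm_big.
  apply: uniq_perm; rewrite ?filter_uniq// => i.
  by rewrite !mem_filter andbC.
have -> : multisum x * l - (\sum_(i <- A) x i * w K i +
    \sum_(i <- [seq i <- E K | i \notin A]) x i * w K i) =
  (\sum_(i <- A) x i * l - \sum_(i <- A) x i * w K i) +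
  ((multisum x - \sum_(i <- A) x i) * l -
    \sum_(i <- [seq i <- E K | i \notin A]) x i * w K i).
  by rewrite mulrBl -big_distrl/=; ring.
rewrite (le_lt_trans (ler_normD _ _))// [eps]splitr ltr_leD//.
have -> : eps / 2 = (d + d) * `|l| + d * B + d.
  by rewrite /d /D; field; rewrite -/D (gt_eqF D0).
rewrite (le_trans (ler_normB _ _))//.
apply: (@le_trans _ _ ((d + d) * `|l| + d * B)); last by rewrite lerDl ltW.
apply: lerD.
  by rewrite normrM ler_wpM2r// ltW// multisum_sub_le.
rewrite (le_trans (ler_norm_sum _ _ _))//.
apply: (@le_trans _ _ (\sum_(i <- [seq i <- E K | i \notin A]) `|x i| * B)).
  by apply: ler_sum => i _; rewrite normrM ler_wpM2l.
rewrite -mulr_suml ler_wpM2r ?(B0 i0)// ltW// hA ?filter_uniq// => i.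
by rewrite mem_filter => /andP[].
Qed.

(** [tannery] with the indicator functions of the sets E K as weights. *)
Lemma multisum_exhaust I (x : I -> C) (E : nat -> seq I) :
  abs_bounded x -> (forall K, uniq (E K)) ->
  (forall i, \forall K \near \oo, i \in E K) ->
  (fun K => \sum_(i <- E K) x i) @ \oo --> multisum x.
Proof.
move=> bx uE hE.
have := @tannery I x (fun K i => (i \in E K)%:R) E 1 1 bx.
have -> : (fun K => \sum_(i <- E K) x i * (i \in E K)%:R) = (fun K => \sum_(i <- E K) x i).
  apply/funext => K; rewrite big_seq [RHS]big_seq; apply: eq_bigr => i ->.
  by rewrite mulr1.
rewrite mulr1; apply => //.
- by move=> K i; case: (i \in E K); rewrite ?normr1 ?normr0.
- move=> i; apply: cvg_near_cst; near=> K.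
  by have -> : i \in E K by near: K.
- by move=> K i /negbTE ->.
Unshelve. all: end_near.
Qed.

End AbsoluteSums.

(** * Completeness of the complex numbers *)

Section ComplexComplete.
Variable R : realType.
Let K : numFieldType := R[i].

Lemma nonneg_summable (I : choiceType) (y : I -> K) :
  (forall i, 0 <= y i) -> abs_bounded y -> is_summable y.
Proof.
move=> y0 [M hM].
pose z i := complex.Re (y i : R[i]).
have yz i : y i = (z i)%:C%C by rewrite /z RRe_real//; exact: ger0_real.
have sumyz (A : {fset I}) : \sum_(i <- A) y i = (\sum_(i <- A) z i)%:C%C.
  by rewrite raddf_sum; apply: eq_bigr => i _; exact: yz.
have z0 i : 0 <= z i by rewrite -lecR -yz; exact: y0.
pose S : set R := [set \sum_(i <- A) z i | A in [set: {fset I}]].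
have supS : has_sup S.
  split; first by exists (\sum_(i <- fset0) z i); exists fset0.
  exists (complex.Re (M : R[i])) => _ [A _ <-].
  have : \sum_(i <- A) y i <= M.
    have := hM A (fset_uniq _); congr (_ <= _).
    by apply: eq_bigr => i _; rewrite ger0_norm.
  by rewrite sumyz lecE => /andP[].
apply/cvg_ex; exists ((sup S)%:C%C : K).
apply/totally_cvgP => eps eps0.
have epsE : eps = (complex.Re (eps : R[i]))%:C%C.
  by rewrite RRe_real//; exact: gtr0_real.
have e0 : 0 < complex.Re (eps : R[i]) by rewrite -ltcR -epsE.
have [_ [A _ <-] hA] := sup_adherent e0 supS.
exists A => B AB.
have BS : \sum_(i <- B) z i <= sup S by apply: sup_upper_bound => //; exists B.
have ABz : \sum_(i <- A) z i <= \sum_(i <- B) z i.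
  rewrite -lecR -!sumyz; apply: ler_sum_sub => //; exact/fsubsetP.
rewrite sumyz -raddfB/= ger0_norm; last by rewrite ler0c subr_ge0.
by rewrite epsE ltcR ltrBlDl -ltrBlDr (lt_le_trans hA).
Qed.

(** The positive and negative parts of the real and imaginary parts are four non-negative families
    dominated by |x|; each converges to the supremum of its finite sums. *)
Lemma complex_abs_complete : abs_complete R[i].
Proof.
move=> I x bx.
pose part (h : R[i] -> R) (i : I) : K := (Num.max (h (x i)) 0)%:C%C.
have bpart (h : R[i] -> R) : (forall z : R[i], `|h z|%:C%C <= `|z|) -> is_summable (part h).
  move=> hz; apply: nonneg_summable => [i|]; first by rewrite ler0c le_max lexx orbT.
  apply: (@abs_bounded_le _ _ _ x 1) => // i; rewrite mul1r.
  apply: le_trans (hz _); rewrite ger0_norm ?lecR ?ler0c ?le_max ?lexx ?orbT//.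
  by rewrite ge_max ler_norm normr_ge0.
have cRe := bpart _ (@normc_ge_Re R).
have cReN := bpart (fun z => - complex.Re z) ltac:(by move=> z; rewrite normrN normc_ge_Re).
have hIm (z : R[i]) : `|complex.Im z|%:C%C <= `|z|.
  case: z => a b; rewrite normc_def lecR /= -sqrtr_sqr ler_sqrt ?lerDr ?sqr_ge0//.
  by rewrite addr_ge0 ?sqr_ge0.
have cIm := bpart _ hIm.
have cImN := bpart (fun z => - complex.Im z) ltac:(by move=> z; rewrite normrN hIm).
have maxE (a : R) : Num.max a 0 - Num.max (- a) 0 = a.
  by case: (lerP a 0) => a0; case: (lerP (- a) 0) => b0; lra.
rewrite /is_summable.
have -> : partial_sum x = (fun A => (partial_sum (part (@complex.Re R)) A
    - partial_sum (part (fun z => - complex.Re z)) A)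
   + ('i%C : K) * (partial_sum (part (@complex.Im R)) A
    - partial_sum (part (fun z => - complex.Im z)) A)).
  apply/funext => A; rewrite /partial_sum -!sumrB big_distrr/= -big_split/=.
  apply: eq_bigr => i _; rewrite /part -!raddfB/= !maxE.
  by rewrite -complexE.
apply: cvgP; apply: cvgD; first by apply: cvgB; [exact: cRe|exact: cReN].
by apply: cvgM; [exact: cvg_cst|apply: cvgB; [exact: cIm|exact: cImN]].
Qed.

End ComplexComplete.

(** * Bounds and limits of q-Pochhammer products *)

Section QPochhammerLimits.
Variable C : numFieldType.
Hypothesis Ccomplete : abs_complete C.
Implicit Types a p : C.

Lemma qpochD a p m n : qpoch a p (m + n) = qpoch a p m * qpoch (a * p ^+ m) p n.
Proof.
elim: n => [|n IH]; first by rewrite addn0 qpoch0 mulr1.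
by rewrite addnS !qpochSr IH exprD; ring.
Qed.

(** The inductive statement is the sharper geometric bound 2|a|(1 - |p|^n)/(1 - |p|): it implies
    |(a;p)_n| <= 2, which the next step needs, and the constant 4 brings it below 1/2. *)
Lemma qpoch_near1 a p n : `|p| < 1 -> 4 * `|a| <= 1 - `|p| ->
  `|qpoch a p n - 1| <= 2^-1.
Proof.
move=> p1 ap; have p1' : 0 < 1 - `|p| by rewrite subr_gt0.
suff h : `|qpoch a p n - 1| * (1 - `|p|) <= 2 * `|a| * (1 - `|p| ^+ n).
  rewrite -(ler_pM2r p1') (le_trans h)//.
  apply: (@le_trans _ _ (2 * `|a|)).
    by rewrite ler_piMr ?mulr_ge0// lerBlDr lerDl exprn_ge0.
  have -> : 2 * `|a| = 2^-1 * (4 * `|a|) by field.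
  by rewrite ler_pM2l ?invr_gt0.
elim: n => [|n IH]; first by rewrite qpoch0 expr0 !subrr normr0 mul0r mulr0.
have qn : `|qpoch a p n| <= 2.
  have -> : qpoch a p n = (qpoch a p n - 1) + 1 by ring.
  rewrite (le_trans (ler_normD _ _))// normr1.
  have -> : (2 : C) = 1 + 1 by ring.
  rewrite lerD2r -(ler_pM2r p1') mul1r (le_trans IH)//.
  apply: (@le_trans _ _ (4 * `|a|)) => //.
  apply: (@le_trans _ _ (2 * `|a|)).
    by rewrite ler_piMr ?mulr_ge0// lerBlDr lerDl exprn_ge0.
  by rewrite ler_wpM2r// ler_nat.
have -> : qpoch a p n.+1 - 1 = (qpoch a p n - 1) - qpoch a p n * (a * p ^+ n).
  by rewrite qpochSr; ring.
apply: (@le_trans _ _ ((`|qpoch a p n - 1| + 2 * (`|a| * `|p| ^+ n)) * (1 - `|p|))).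
  rewrite ler_wpM2r ?(ltW p1')// (le_trans (ler_normB _ _))// lerD2l.
  by rewrite !normrM normrX ler_wpM2r// mulr_ge0// exprn_ge0.
rewrite mulrDl exprS.
have -> : 2 * `|a| * (1 - `|p| * `|p| ^+ n) = 2 * `|a| * (1 - `|p| ^+ n) +
  2 * (`|a| * `|p| ^+ n) * (1 - `|p|) by ring.
by rewrite lerD2r.
Qed.

(** The field is not assumed archimedean; smallness of |p|^k is read off from the tails of the
    geometric family. *)
Lemma expr_small p (eps : C) : `|p| < 1 -> 0 < eps -> exists k, `|p| ^+ k < eps.
Proof.
move=> p1 eps0.
have [A hA] := abs_bounded_tail Ccomplete (abs_bounded_geometric p1) eps0.
exists (\max_(i <- A) i).+1.
have := hA [:: (\max_(i <- A) i).+1] isT.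
rewrite big_seq1 normrX; apply => i; rewrite inE => /eqP ->.
apply/negP => h; have := @leq_bigmax_seq _ (enum_fset A) predT id _ h isT.
by rewrite ltnn.
Qed.

Lemma qpoch_tail_near1 a p : `|p| < 1 ->
  exists k, forall n, `|qpoch (a * p ^+ k) p n - 1| <= 2^-1.
Proof.
move=> p1; have p1' : 0 < 1 - `|p| by rewrite subr_gt0.
have a0 : 0 < 4 * (`|a| + 1) by rewrite mulr_gt0// ltr_wpDl.
have [k hk] := expr_small p1 (divr_gt0 p1' a0).
exists k => n; apply: qpoch_near1 => //.
move: hk; rewrite ltr_pdivlMr// => /ltW; apply: le_trans.
rewrite normrM normrX mulrA mulrC ler_wpM2l ?exprn_ge0//.
by rewrite ler_wpM2l// lerDl.
Qed.

Lemma qpoch_bounded a p : `|p| < 1 -> exists2 B, 0 <= B & forall n, `|qpoch a p n| <= B.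
Proof.
move=> p1; have [k hk] := qpoch_tail_near1 a p1.
have tail n : `|qpoch (a * p ^+ k) p n| <= 2.
  have -> : qpoch (a * p ^+ k) p n = (qpoch (a * p ^+ k) p n - 1) + 1 by ring.
  rewrite (le_trans (ler_normD _ _))// normr1.
  have -> : (2 : C) = 1 + 1 by ring.
  by rewrite lerD2r (le_trans (hk n))// invf_le1 ?ler1n.
(* For n <= k the n-th summand suffices; for n > k the summand i = k does, the factor 2 bounding the
   remaining product. *)
exists (\sum_(i < k.+1) `|qpoch a p i| * 2) => [|n].
  by rewrite sumr_ge0// => i _; rewrite mulr_ge0.
have [nk|kn] := ltnP n k.+1.
  rewrite (bigD1 (Ordinal nk))//= -[leLHS]addr0 lerD//.
    by rewrite ler_peMr// ler1n.
  by rewrite sumr_ge0// => i _; rewrite mulr_ge0.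
rewrite big_ord_recr/= -[leLHS]add0r lerD//.
  by rewrite sumr_ge0// => i _; rewrite mulr_ge0.
have -> : n = (k + (n - k))%N by lia.
by rewrite qpochD normrM ler_wpM2l.
Qed.

(** The increments are -a (a;p)_n p^n, dominated by a geometric family, and the products are their
    telescoping sums. *)
Lemma qpoch_cvg a p : `|p| < 1 -> qpoch a p @ \oo --> qpoch_inf a p.
Proof.
move=> p1; have [B B0 hB] := qpoch_bounded a p1.
pose d n := qpoch a p n.+1 - qpoch a p n.
have bd : abs_bounded d.
  apply: (abs_bounded_le (mulr_ge0 (normr_ge0 a) B0) _ (abs_bounded_geometric p1)) => n.
  have -> : d n = - (a * qpoch a p n * p ^+ n) by rewrite /d qpochSr; ring.
  rewrite normrN normrM ler_wpM2r// normrM ler_wpM2l//.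
have h := @multisum_exhaust C Ccomplete _ d (fun K => iota 0 K) bd.
have {}h : (fun n => \sum_(i <- iota 0 n) d i) @ \oo --> multisum d.
  apply: h => [K|i]; first exact: iota_uniq.
  by exists i.+1 => // K /=; rewrite mem_iota.
suff : cvg (qpoch a p @ \oo) by [].
apply/cvg_ex; exists (1 + multisum d).
have -> : qpoch a p = (fun n => 1 + \sum_(i <- iota 0 n) d i).
  apply/funext => n.
  rewrite -[n in iota _ n]subn0 -/(index_iota 0 n) telescope_sumr// qpoch0; ring.
by apply: cvgD h; exact: cvg_cst.
Qed.

Lemma inv_qpoch_bounded a p : `|p| < 1 -> (forall i, a * p ^+ i != 1) ->
  exists2 B, 0 <= B & forall n, `|(qpoch a p n)^-1| <= B.
Proof.
move=> p1 ap; have [k hk] := qpoch_tail_near1 a p1.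
have qpoch_ge_half n : 2^-1 <= `|qpoch (a * p ^+ k) p n|.
  have h := ler_normD (qpoch (a * p ^+ k) p n) (1 - qpoch (a * p ^+ k) p n).
  rewrite addrC subrK normr1 distrC in h.
  have -> : (2^-1 : C) = 1 - 2^-1 by field.
  by rewrite lerBlDr (le_trans h)// lerD2l.
have tail n : `|(qpoch (a * p ^+ k) p n)^-1| <= 2.
  rewrite normfV -[leRHS]invrK lef_pV2 ?posrE ?invr_gt0//.
  by rewrite (lt_le_trans _ (qpoch_ge_half n))// invr_gt0.
exists (\sum_(i < k.+1) `|(qpoch a p i)^-1| * 2) => [|n].
  by rewrite sumr_ge0// => i _; rewrite mulr_ge0.
have [nk|kn] := ltnP n k.+1.
  rewrite (bigD1 (Ordinal nk))//= -[leLHS]addr0 lerD//.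
    by rewrite ler_peMr// ler1n.
  by rewrite sumr_ge0// => i _; rewrite mulr_ge0.
rewrite big_ord_recr/= -[leLHS]add0r lerD//.
  by rewrite sumr_ge0// => i _; rewrite mulr_ge0.
have -> : n = (k + (n - k))%N by lia.
by rewrite qpochD invfM normrM ler_wpM2l.
Qed.

(** The reciprocals of the partial products are bounded, so these products stay away from 0. *)
Lemma qpoch_inf_neq0 a p : `|p| < 1 -> (forall i, a * p ^+ i != 1) ->
  qpoch_inf a p != 0.
Proof.
move=> p1 ap; have [B B0 hB] := inv_qpoch_bounded p1 ap.
apply/eqP => h0; have := qpoch_cvg (a := a) p1; rewrite h0.
move=> /cvgrPdist_lt/(_ (B + 1)^-1) h.
have B1 : 0 < B + 1 by rewrite ltr_wpDl.
have [|N _ hN] := h; first by rewrite invr_gt0.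
have {hN} := hN N (leqnn _); rewrite /= sub0r normrN.
have qn : qpoch a p N != 0 by apply: qpoch_neq0.
rewrite -[ltLHS]invrK ltf_pV2 ?posrE ?invr_gt0 ?normr_gt0//.
rewrite -normfV => h1; have := lt_le_trans h1 (hB N).
by rewrite -[ltRHS]addr0 ltrD2l ltr10.
Qed.

Lemma inv_qpoch_cvg a p : `|p| < 1 -> (forall i, a * p ^+ i != 1) ->
  (fun n => (qpoch a p n)^-1) @ \oo --> (qpoch_inf a p)^-1.
Proof. move=> p1 ap; apply: cvgV; [exact: qpoch_inf_neq0|exact: qpoch_cvg]. Qed.

End QPochhammerLimits.

(** * The finite form of the quintuple product *)

Section Quintuple.
Variable C : numFieldType.

(** The variable z is free in the induction because the step evaluates the sum at z and at z p.
    Non-vanishing of all denominators follows from the hypothesis on z^2, which also excludes z p^i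
    = 1. *)
Lemma finite_quintuple (p : C) (n : nat) (z : C) : `|p| < 1 ->
  (forall i : nat, z ^+ 2 * p ^+ i != 1) ->
  \sum_(0 <= k < n.+1) (1 + z * p ^+ k) * z ^+ k * p ^+ (k * k)
     * (inv_qpoch p (n%:Z - k%:Z) * inv_qpoch p k%:Z) / qpoch (z ^+ 2 * p ^+ k) p n.+1
  = inv_qpoch p n%:Z / qpoch z p n.+1.
Proof.
move=> p1; have zsq (u : C) : (forall i : nat, u ^+ 2 * p ^+ i != 1) ->
    forall i, u * p ^+ i != 1.
  move=> hu i; apply: contra_neq (hu (i * 2)%N).
  by rewrite exprM -exprMn => ->; rewrite expr1n.
elim: n z => [|n IH] z hz.
  have h0 := zsq _ hz 0%N; rewrite expr0 mulr1 in h0.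
  have h1 := hz 0%N; rewrite expr0 mulr1 in h1.
  rewrite big_nat1 !qpochSr !qpoch0 !expr0 /= qpoch0 invr1 !(mulr1, mul1r).
  have d1 : 1 - z != 0 by rewrite subr_eq0 eq_sym.
  have d2 : 1 - z ^+ 2 != 0 by rewrite subr_eq0 eq_sym.
  by field; rewrite d1 d2.
have hz' (i : nat) : (z * p) ^+ 2 * p ^+ i != 1.
  by rewrite exprMn -mulrA -exprD.
have zn : 1 - z ^+ 2 * p ^+ n.+1 != 0 by rewrite subr_eq0 eq_sym.
have pn := subr1X_neq0 p1 (isT : (0 < n.+1)%N).
apply: (mulfI (mulf_neq0 pn zn)).
(* If J_n(z) is the sum to be evaluated, then
   (1 - p^(n+1)) (1 - z^2 p^(n+1)) J_(n+1)(z) = J_n(z) + z p^(n+1) J_n(zp). *)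
transitivity (inv_qpoch p n%:Z / qpoch z p n.+1 +
    z * p ^+ n.+1 * (inv_qpoch p n%:Z / qpoch (z * p) p n.+1)).
  rewrite -(IH z hz) -(IH (z * p) hz') !big_distrr.
  have -> : \sum_(0 <= i < n.+1) z * p ^+ n.+1 *
      ((1 + z * p * p ^+ i) * (z * p) ^+ i * p ^+ (i * i) *
       (inv_qpoch p (n%:Z - i%:Z) * inv_qpoch p i%:Z) /
       qpoch ((z * p) ^+ 2 * p ^+ i) p n.+1) =
    \sum_(0 <= k < n.+2) (1 + z * p ^+ k) * z ^+ k * p ^+ (k * k) * p ^+ (n.+1 - k) *
      (inv_qpoch p (n.+1%:Z - k%:Z) * inv_qpoch p (k%:Z - 1)) *
      (1 - z ^+ 2 * p ^+ k) / qpoch (z ^+ 2 * p ^+ k) p n.+2.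
    rewrite [RHS]big_nat_recl// [inv_qpoch p (0%:Z - 1)]inv_qpoch_lt0//.
    rewrite !(mulr0, mul0r) add0r; apply: eq_big_nat => i /andP[_ ni].
    have -> : n.+1%:Z - i.+1%:Z = n%:Z - i%:Z by lia.
    have -> : i.+1%:Z - 1 = i by lia.
    have -> : (z * p) ^+ 2 * p ^+ i = z ^+ 2 * p ^+ i.+1 * p by rewrite !exprS; ring.
    rewrite [qpoch _ _ n.+2]qpochS.
    have d1 : 1 - z ^+ 2 * p ^+ i.+1 != 0 by rewrite subr_eq0 eq_sym.
    have d2 : qpoch (z ^+ 2 * p ^+ i.+1 * p) p n.+1 != 0.
      apply: qpoch_neq0 => j _.
      have -> : z ^+ 2 * p ^+ i.+1 * p * p ^+ j = z ^+ 2 * p ^+ (i.+2 + j) by rewrite exprD !exprS; ring.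
      exact: hz.
    have -> : (i.+1 * i.+1 = i * i + i + i.+1)%N by lia.
    have -> : p ^+ n.+1 = p ^+ (n.+1 - i.+1) * p ^+ i.+1.
      by rewrite -exprD; congr (_ ^+ _); lia.
    rewrite !exprD exprMn [z ^+ i.+1]exprS [p ^+ i.+1]exprS.
    rewrite [p ^+ i.+1]exprS in d1 d2.
    by field; rewrite d1 d2.
  have -> : \sum_(0 <= i < n.+1) (1 + z * p ^+ i) * z ^+ i * p ^+ (i * i) *
     (inv_qpoch p (n%:Z - i%:Z) * inv_qpoch p i%:Z) / qpoch (z ^+ 2 * p ^+ i) p n.+1 =
    \sum_(0 <= k < n.+2) (1 + z * p ^+ k) * z ^+ k * p ^+ (k * k) *
     (inv_qpoch p (n%:Z - k%:Z) * inv_qpoch p k%:Z) *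
     (1 - z ^+ 2 * p ^+ k * p ^+ n.+1) / qpoch (z ^+ 2 * p ^+ k) p n.+2.
    rewrite [RHS]big_nat_recr// [inv_qpoch p (n%:Z - n.+1%:Z)]inv_qpoch_lt0; last by lia.
    rewrite !(mulr0, mul0r) [RHS]addr0; apply: eq_big_nat => i _.
    rewrite [qpoch _ _ n.+2]qpochSr.
    have d1 : 1 - z ^+ 2 * p ^+ i * p ^+ n.+1 != 0.
      by rewrite subr_eq0 eq_sym -mulrA -exprD.
    have d2 : qpoch (z ^+ 2 * p ^+ i) p n.+1 != 0.
      by apply: qpoch_neq0 => j _; rewrite -mulrA -exprD.
    by field; rewrite d1 d2.
  (* Term by term, with x = p^(n+1-k) and y = p^k: (1 - x)(1 - z^2 x y^2) + x (1 - y)(1 - z^2 y) =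
     (1 - x y)(1 - z^2 x y). *)
  rewrite -big_split; apply: eq_big_nat => k /andP[_ kn]; rewrite /=.
  have -> : n%:Z - k%:Z = n.+1%:Z - k%:Z - 1 by lia.
  rewrite !inv_qpoch_pred//.
  have -> : absz (n.+1%:Z - k%:Z) = (n.+1 - k)%N by lia.
  have -> : p ^+ n.+1 = p ^+ (n.+1 - k) * p ^+ k by rewrite -exprD; congr (_ ^+ _); lia.
  rewrite absz_nat -?inv_qpochE; ring.
have -> : inv_qpoch p n%:Z = (1 - p ^+ n.+1) * inv_qpoch p n.+1%:Z.
  have -> : n%:Z = n.+1%:Z - 1 by lia.
  by rewrite inv_qpoch_pred.
have hq := zsq _ hz; have hq' := zsq _ hz'.
have d1 : qpoch z p n.+1 != 0 by apply: qpoch_neq0 => i _; exact: hq.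
have d2 : 1 - z * p ^+ n.+1 != 0 by rewrite subr_eq0 eq_sym hq.
have d3 : 1 - z != 0 by rewrite subr_eq0 eq_sym; have := hq 0%N; rewrite expr0 mulr1.
have -> : qpoch (z * p) p n.+1 = qpoch z p n.+1 * (1 - z * p ^+ n.+1) / (1 - z).
  by rewrite -qpochSr [qpoch z p n.+2]qpochS; field.
rewrite [qpoch z p n.+2]qpochSr.
by field; rewrite d1 d2 d3.
Qed.

(** Factor by factor, 1 - x p^(-i) = -x p^(-i) (1 - p^i / x) for 1 <= i <= k. *)
Lemma qpoch_rev (p x : C) (k : nat) : p != 0 -> x != 0 ->
  qpoch (x / p ^+ k) p k = (- x) ^+ k / p ^+ 'C(k.+1, 2) * qpoch (p / x) p k.
Proof.
move=> p0 x0; elim: k => [|k IH]; first by rewrite !qpoch0 !expr0 invr1 !mulr1.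
have pk : p ^+ k != 0 by rewrite expf_neq0.
have pt : p ^+ 'C(k.+1, 2) != 0 by rewrite expf_neq0.
rewrite qpochS.
have -> : x / p ^+ k.+1 * p = x / p ^+ k by rewrite exprS; field; rewrite pk p0.
rewrite IH qpochSr triS exprD !exprS.
by field; rewrite x0 pk p0 pt.
Qed.

Lemma qpoch_rev_split (p x : C) (k l : nat) : p != 0 -> x != 0 ->
  qpoch (x / p ^+ k) p (k + l) =
    (- x) ^+ k / p ^+ 'C(k.+1, 2) * qpoch (p / x) p k * qpoch x p l.
Proof.
move=> p0 x0; rewrite qpochD qpoch_rev//; congr (_ * qpoch _ _ _).
by rewrite divfK// expf_neq0.
Qed.

Definition quintuple_term (p z : C) (j : int) : C :=
  (1 - z * p ^ j) * z ^ (3 * j) * p ^ ((j * (3 * j - 1)) %/ 2)%Z.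

Lemma quintuple_term_shift (p z : C) (m k : nat) : p != 0 -> z != 0 -> (k <= 2 * m)%N ->
  let zeta := - z / p ^+ m in
  (1 + zeta * p ^+ k) * zeta ^+ k * p ^+ (k * k) *
     (z ^+ m / p ^+ 'C(m.+1, 2)) /
     ((- z ^+ 2) ^+ (2 * m - k) / p ^+ 'C((2 * m - k).+1, 2)) =
  quintuple_term p z (k%:Z - m%:Z).
Proof.
move=> p0 z0 km zeta; rewrite /quintuple_term.
set h := (2 * m - k)%N.
have hk : (k + h = 2 * m)%N by rewrite /h; lia.
have pm : p ^+ m != 0 by rewrite expf_neq0.
(* Since k + h = 2m is even, the signs of zeta^k and of (-z^2)^h cancel. *)
have sgn : (-1) ^+ k = (-1) ^+ h :> C.
  by rewrite -signr_odd -[RHS]signr_odd; congr (_ ^+ _); congr nat_of_bool; lia.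
have sgn0 : (-1) ^+ h != 0 :> C by rewrite expf_neq0// oppr_eq0 oner_eq0.
have -> : zeta * p ^+ k = - (z * p ^ (k%:Z - m%:Z)).
  by rewrite /zeta expfzDr// -exprnN -!exprnP; ring.
rewrite -[RHS]mulrA -[LHS]mulrA -!mulrA; congr (_ * _).
have -> : zeta ^+ k = (-1) ^+ h * z ^+ k / p ^+ (m * k).
  by rewrite /zeta -[- z]mulN1r !exprMn sgn exprVn -exprM.
have -> : (- z ^+ 2) ^+ h = (-1) ^+ h * z ^+ (2 * h) by rewrite -[- z ^+ 2]mulN1r exprMn -exprM.
have -> : z ^ (3 * (k%:Z - m%:Z)) = z ^+ k * z ^+ m / z ^+ (2 * h).
  rewrite -exprD !exprnP exprnN -expfzDr//; congr (_ ^ _); lia.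
have e2 : p ^ ((k%:Z - m%:Z) * (3 * (k%:Z - m%:Z) - 1) %/ 2)%Z =
   p ^+ (k * k) * p ^+ 'C(h.+1, 2) / (p ^+ (m * k) * p ^+ 'C(m.+1, 2)).
  rewrite -!exprD !exprnP exprnN -expfzDr//; congr (_ ^ _).
  have ha : 2 * 'C(m.+1, 2)%:Z = m%:Z * (m%:Z + 1) by have := triE2 m; lia.
  have hb : 2 * 'C(h.+1, 2)%:Z = h%:Z * (h%:Z + 1) by have := triE2 h; lia.
  have kE : k%:Z = 2 * m%:Z - h%:Z by lia.
  have hj : (k%:Z - m%:Z) * (3 * (k%:Z - m%:Z) - 1) =
      2 * ((k * k + 'C(h.+1, 2))%:Z - (m * k + 'C(m.+1, 2))%:Z).
    move: ('C(h.+1, 2)) ('C(m.+1, 2)) ha hb => b a ha hb.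
    rewrite !PoszD !PoszM kE.
    transitivity (2 * ((2 * m%:Z - h%:Z) * (2 * m%:Z - h%:Z) - m%:Z * (2 * m%:Z - h%:Z))
      + h%:Z * (h%:Z + 1) - m%:Z * (m%:Z + 1)); first by ring.
    by rewrite -ha -hb; ring.
  by lia.
rewrite {}e2.
have d1 : z ^+ (2 * h) != 0 by rewrite expf_neq0.
have d2 n : p ^+ n != 0 by rewrite expf_neq0.
by field; rewrite sgn0 d1 !d2.
Qed.

End Quintuple.

(** * The quintuple product as a limit *)

Lemma cvg_reindex (T : topologicalType) (u : nat -> T) (l : T) (phi : nat -> nat) :
  (forall N, exists M, forall m, (M <= m)%N -> (N <= phi m)%N) ->
  u @ \oo --> l -> (fun m => u (phi m)) @ \oo --> l.
Proof.
move=> hphi ul P /ul[N _ hN]; have [M hM] := hphi N.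
by exists M => // m Mm; apply: hN; exact: hM.
Qed.

Definition int_range (m : nat) : seq int := [seq i%:Z - m%:Z | i <- iota 0 (2 * m).+1].

Lemma int_range_uniq m : uniq (int_range m).
Proof. by rewrite map_inj_uniq ?iota_uniq// => i j; lia. Qed.

Lemma mem_int_range m j : (j \in int_range m) = (absz j <= m)%N.
Proof.
apply/mapP/idP => [[k]|jm]; first by rewrite mem_iota => /andP[_ im] ->; lia.
by exists (absz (j + m%:Z)); [rewrite mem_iota|]; lia.
Qed.

Lemma sum_int_range (V : zmodType) m (F : int -> V) :
  \sum_(j <- int_range m) F j = bisum m F.
Proof. by rewrite big_map /bisum /index_iota subn0. Qed.

Lemma cvg_seq_unique (C : numFieldType) (u : nat -> C) (a b : C) :
  u @ \oo --> a -> u @ \oo --> b -> a = b.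
Proof.
by move=> ua ub; rewrite -(cvg_lim (@norm_hausdorff _ _) ua) -(cvg_lim (@norm_hausdorff _ _) ub).
Qed.

Section QuintupleLimit.
Variable C : numFieldType.
Hypothesis Ccomplete : abs_complete C.
Implicit Types p q z : C.

Lemma qq_neq1 q : `|q| < 1 -> forall i, q * q ^+ i != 1.
Proof.
move=> q1 i; rewrite -exprS eq_sym -subr_eq0; exact: subr1X_neq0.
Qed.

Lemma inv_qpoch_int_bounded q : `|q| < 1 ->
  exists2 B, 0 <= B & forall k, `|inv_qpoch q k| <= B.
Proof.
move=> q1; have [B B0 hB] := inv_qpoch_bounded Ccomplete q1 (qq_neq1 q1).
by exists B => // -[n|n]; rewrite /inv_qpoch ?normr0.
Qed.

Lemma inv_qpoch_int_cvg q (phi : nat -> int) : `|q| < 1 ->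
  (forall N : nat, exists M, forall m, (M <= m)%N -> N%:Z <= phi m) ->
  (fun m => inv_qpoch q (phi m)) @ \oo --> (qpoch_inf q q)^-1.
Proof.
move=> q1 hphi.
apply: cvg_trans; last first.
  apply: (cvg_reindex (phi := fun m => absz (phi m)) _
    (inv_qpoch_cvg Ccomplete q1 (qq_neq1 q1))).
  by move=> N; have [M hM] := hphi N; exists M => m /hM; lia.
have [M hM] := hphi 0%N; apply: near_eq_cvg; exists M => // m /= /hM.
by case: (phi m).
Qed.

(** What remains of the j-th term of the recentred finite identity after division by
    [quintuple_term]. For |j| <= m the absolute values change nothing; for other j an [inv_qpoch]
    factor is 0. *)
Definition quintuple_weight p z (m : nat) (j : int) : C :=
  qpoch p p (2 * m) * qpoch (- z) p m.+1 * qpoch (p / - z) p m *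
  (inv_qpoch p (m%:Z - j) * inv_qpoch p (m%:Z + j)) *
  (qpoch (z ^+ 2) p (absz (m%:Z + j + 1)))^-1 *
  (qpoch (p / z ^+ 2) p (absz (m%:Z - j)))^-1.

Section QuintupleWeight.
Variables p z : C.
Hypotheses (p0 : p != 0) (p1 : `|p| < 1) (z0 : z != 0).
Hypothesis hz : forall i : int, z ^+ 2 * p ^ i != 1.

Lemma sqr_expr_neq1 i : z ^+ 2 * p ^+ i != 1.
Proof. exact: (hz i%:Z). Qed.

Lemma inv_sqr_expr_neq1 i : p / z ^+ 2 * p ^+ i != 1.
Proof.
have := hz (- (i.+1%:Z)); apply: contra_neq => h.
have -> : z ^+ 2 = p ^+ i.+1 by rewrite -[LHS]mul1r -h [p ^+ i.+1]exprS; field.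
by rewrite -exprnN divff// expf_neq0.
Qed.

Lemma quintuple_weight_bounded : exists B, forall m j, `|quintuple_weight p z m j| <= B.
Proof.
have [B1 B10 hB1] := qpoch_bounded Ccomplete p p1.
have [B2 B20 hB2] := qpoch_bounded Ccomplete (- z) p1.
have [B3 B30 hB3] := qpoch_bounded Ccomplete (p / - z) p1.
have [B4 B40 hB4] := inv_qpoch_int_bounded p1.
have [B5 B50 hB5] := inv_qpoch_bounded Ccomplete p1 sqr_expr_neq1.
have [B6 B60 hB6] := inv_qpoch_bounded Ccomplete p1 inv_sqr_expr_neq1.
exists (B1 * B2 * B3 * (B4 * B4) * B5 * B6) => m j.
by rewrite /quintuple_weight !normrM; do ! (apply: ler_pM => //; rewrite ?mulr_ge0//).
Qed.

Lemma quintuple_weight_cvg j : (quintuple_weight p z)^~ j @ \oo -->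
  qpoch_inf p p * qpoch_inf (- z) p * qpoch_inf (p / - z) p *
  ((qpoch_inf p p)^-1 * (qpoch_inf p p)^-1) *
  (qpoch_inf (z ^+ 2) p)^-1 * (qpoch_inf (p / z ^+ 2) p)^-1.
Proof.
have sub N : exists M, forall m, (M <= m)%N -> N%:Z <= m%:Z - j.
  by exists (N + absz j)%N => m; lia.
have add N : exists M, forall m, (M <= m)%N -> N%:Z <= m%:Z + j.
  by exists (N + absz j)%N => m; lia.
apply: cvgM; last first.
  apply: (cvg_reindex (phi := fun m => absz (m%:Z - j)) _
    (inv_qpoch_cvg Ccomplete p1 inv_sqr_expr_neq1)).
  by move=> N; have [M hM] := sub N; exists M => m /hM; lia.
apply: cvgM; last first.
  apply: (cvg_reindex (phi := fun m => absz (m%:Z + j + 1)) _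
    (inv_qpoch_cvg Ccomplete p1 sqr_expr_neq1)).
  by move=> N; have [M hM] := add N; exists M => m /hM; lia.
apply: cvgM; last by apply: cvgM; exact: inv_qpoch_int_cvg.
apply: cvgM; last exact: qpoch_cvg.
apply: cvgM.
  refine (@cvg_reindex _ (qpoch p p) _ (fun m => (2 * m)%N) _
    (qpoch_cvg Ccomplete (a := p) p1)).
  by move=> N; exists N => m Nm; rewrite (leq_trans Nm)// leq_pmull.
refine (@cvg_reindex _ (qpoch (- z) p) _ S _ (qpoch_cvg Ccomplete (a := - z) p1)).
by move=> N; exists N => m; exact: leqW.
Qed.

Lemma quintuple_weight_eq0 m j : j \notin int_range m -> quintuple_weight p z m j = 0.
Proof.
rewrite mem_int_range /quintuple_weight => jm.
by rewrite inv_qpochM0 ?mulr0 ?mul0r//; lia.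
Qed.

(** [finite_quintuple] with n = 2m at zeta = -z/p^m and k = j + m, normalised to 1. Reversing the
    products with negative powers of p moves everything that grows with j into [quintuple_term]. *)
Lemma sum_quintuple_weight m :
  \sum_(j <- int_range m) quintuple_term p z j * quintuple_weight p z m j = 1.
Proof.
pose zeta := - z / p ^+ m.
have pm k : p ^+ k != 0 by rewrite expf_neq0.
have hzeta i : zeta ^+ 2 * p ^+ i != 1.
  have -> : zeta ^+ 2 * p ^+ i = z ^+ 2 * p ^ (i%:Z - (2 * m)%:Z).
    rewrite expfzDr// -exprnN -exprnP /zeta mulnC exprM exprMn sqrrN exprVn; ring.
  exact: hz.
have := finite_quintuple (2 * m) p1 hzeta.
have zetaE : qpoch zeta p (2 * m).+1 =
    z ^+ m / p ^+ 'C(m.+1, 2) * qpoch (p / - z) p m * qpoch (- z) p m.+1.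
  have -> : (2 * m).+1 = (m + m.+1)%N by rewrite addnS addnn -mul2n.
  by rewrite /zeta qpoch_rev_split// ?opprK// oppr_eq0.
have zeta_neq0 : qpoch zeta p (2 * m).+1 != 0.
  apply: qpoch_neq0 => i _; apply: contra_neq (hzeta (i * 2)%N).
  by rewrite exprM -exprMn => ->; rewrite expr1n.
move=> /(congr1 (fun x => qpoch p p (2 * m) * qpoch zeta p (2 * m).+1 * x)).
rewrite [RHS](_ : _ = 1); last first.
  by rewrite inv_qpochE; field; rewrite zeta_neq0 qpochqq_neq0.
move=> <-; rewrite sum_int_range /bisum big_distrr; apply: eq_big_nat => k /andP[_ km].
rewrite /= -quintuple_term_shift//.
rewrite -/zeta zetaE.
have hk : (2 * m = (2 * m - k) + k)%N by rewrite subnK.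
have -> : zeta ^+ 2 * p ^+ k = z ^+ 2 / p ^+ (2 * m - k).
  have -> : zeta ^+ 2 = z ^+ 2 / p ^+ (2 * m).
    by rewrite /zeta exprMn sqrrN exprVn -exprM mulnC.
  by rewrite [in LHS]hk exprD; field; rewrite !pm.
have -> : (2 * m).+1 = ((2 * m - k) + k.+1)%N by rewrite addnS -hk.
rewrite qpoch_rev_split// ?expf_neq0// /quintuple_weight.
have -> : m%:Z + (k%:Z - m%:Z) = k by rewrite addrC subrK.
have -> : absz (k%:Z + 1) = k.+1 by rewrite -PoszD addn1.
have -> : m%:Z - (k%:Z - m%:Z) = (2 * m - k)%N%:Z.
  by rewrite -subzn// mul2n -addnn PoszD; ring.
have -> : (2 * m)%:Z - k%:Z = (2 * m - k)%N%:Z by rewrite subzn.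
rewrite absz_nat !inv_qpochE.
have q1 := qpochqq_neq0 p1.
have q2 n : qpoch (z ^+ 2) p n != 0 by apply: qpoch_neq0 => i _; exact: sqr_expr_neq1.
have q3 n : qpoch (p / z ^+ 2) p n != 0.
  by apply: qpoch_neq0 => i _; exact: inv_sqr_expr_neq1.
have zh : (- z ^+ 2) ^+ (2 * m - k) != 0 by rewrite expf_neq0// oppr_eq0 expf_neq0.
by field; rewrite !pm !q1 q2 q3 zh.
Qed.

Lemma quintuple_sum : abs_bounded (quintuple_term p z) ->
  multisum (quintuple_term p z) * (qpoch_inf (- z) p * qpoch_inf (p / - z) p) =
  qpoch_inf p p * qpoch_inf (z ^+ 2) p * qpoch_inf (p / z ^+ 2) p.
Proof.
move=> bterm; have [B wB] := quintuple_weight_bounded.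
have := tannery Ccomplete bterm wB quintuple_weight_cvg int_range_uniq quintuple_weight_eq0.
rewrite (_ : (fun K => _) = (fun=> 1)); last first.
  by apply/funext => m; exact: sum_quintuple_weight.
move=> lim1; have hl := cvg_seq_unique lim1 (cvg_cst _).
have P0 := qpoch_inf_neq0 Ccomplete p1 (qq_neq1 p1).
have Z0 := qpoch_inf_neq0 Ccomplete p1 sqr_expr_neq1.
have Y0 := qpoch_inf_neq0 Ccomplete p1 inv_sqr_expr_neq1.
rewrite -[RHS]mulr1 -hl.
by field; rewrite P0 Z0 Y0.
Qed.

End QuintupleWeight.

Lemma qpoch_double (x p : C) n :
  qpoch x p (2 * n) = qpoch x (p ^+ 2) n * qpoch (x * p) (p ^+ 2) n.
Proof.
elim: n => [|n IH]; first by rewrite muln0 !qpoch0 mulr1.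
have -> : (2 * n.+1 = (2 * n).+2)%N by lia.
rewrite !qpochSr IH -!exprM [p ^+ (2 * n).+1]exprS; ring.
Qed.

Lemma qpoch_sqr (x p : C) n :
  qpoch (x ^+ 2) (p ^+ 2) n = qpoch x p n * qpoch (- x) p n.
Proof.
elim: n => [|n IH]; first by rewrite !qpoch0 mulr1.
by rewrite !qpochSr IH -exprM mulnC exprM; ring.
Qed.

Lemma norm_sqr_lt1 p : `|p| < 1 -> `|p ^+ 2| < 1.
Proof. by move=> p1; rewrite normrX exprn_ilt1. Qed.

Lemma qpoch_inf_double (x p : C) : `|p| < 1 ->
  qpoch_inf x p = qpoch_inf x (p ^+ 2) * qpoch_inf (x * p) (p ^+ 2).
Proof.
move=> p1; have p2 := norm_sqr_lt1 p1.
have h1 : (fun n => qpoch x p (2 * n)) @ \oo --> qpoch_inf x p.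
  apply: (cvg_reindex (phi := fun m => (2 * m)%N) _ (qpoch_cvg Ccomplete (a := x) p1)).
  by move=> N; exists N => m; lia.
have h2 : (fun n => qpoch x (p ^+ 2) n * qpoch (x * p) (p ^+ 2) n) @ \oo -->
    qpoch_inf x (p ^+ 2) * qpoch_inf (x * p) (p ^+ 2).
  by apply: cvgM; exact: qpoch_cvg.
have E : (fun n => qpoch x p (2 * n)) =
    (fun n => qpoch x (p ^+ 2) n * qpoch (x * p) (p ^+ 2) n).
  by apply/funext => n; exact: qpoch_double.
by rewrite E in h1; exact: cvg_seq_unique h1 h2.
Qed.

Lemma qpoch_inf_sqr (x p : C) : `|p| < 1 ->
  qpoch_inf (x ^+ 2) (p ^+ 2) = qpoch_inf x p * qpoch_inf (- x) p.
Proof.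
move=> p1; have p2 := norm_sqr_lt1 p1.
have h1 := qpoch_cvg Ccomplete (a := x ^+ 2) p2.
have h2 : (fun n => qpoch x p n * qpoch (- x) p n) @ \oo -->
    qpoch_inf x p * qpoch_inf (- x) p.
  by apply: cvgM; exact: qpoch_cvg.
have E : qpoch (x ^+ 2) (p ^+ 2) = (fun n => qpoch x p n * qpoch (- x) p n).
  by apply/funext => n; exact: qpoch_sqr.
by rewrite E in h1; exact: cvg_seq_unique h1 h2.
Qed.

(** Here (z^2;p)_oo = (z;p)_oo (-z;p)_oo (p z^2;p^2)_oo, and similarly for (p/z^2;p)_oo; the factors
    in -z cancel against those of [quintuple_sum]. *)
Lemma quintuple_product p z : p != 0 -> `|p| < 1 -> z != 0 ->
  (forall i : int, z ^+ 2 * p ^ i != 1) -> abs_bounded (quintuple_term p z) ->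
  multisum (quintuple_term p z) =
  qpochs_inf [:: z; p / z; p] p * qpochs_inf [:: p / z ^+ 2; p * z ^+ 2] (p ^+ 2).
Proof.
move=> p0 p1 z0 hz bterm.
have h := quintuple_sum p0 p1 z0 hz bterm.
have n1 : qpoch_inf (- z) p != 0.
  apply: (qpoch_inf_neq0 Ccomplete p1) => i; apply: contra_neq (hz (i * 2)%N).
  by rewrite -exprnP exprM -sqrrN -exprMn => ->; rewrite expr1n.
have n2 : qpoch_inf (p / - z) p != 0.
  apply: (qpoch_inf_neq0 Ccomplete p1) => i; apply: contra_neq (hz (- (i.+1 * 2)%N%:Z)) => hi.
  have -> : z = - p ^+ i.+1.
    by rewrite -[LHS]mul1r -hi [p ^+ i.+1]exprS; field.
  by rewrite sqrrN -exprM -exprnN divff// expf_neq0.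
apply: (mulIf (mulf_neq0 n1 n2)); rewrite h.
rewrite /qpochs_inf !big_cons !big_nil !mulr1.
rewrite (qpoch_inf_double (z ^+ 2) p1) (qpoch_inf_double (p / z ^+ 2) p1).
rewrite (qpoch_inf_sqr _ p1).
have -> : p / z ^+ 2 * p = (p / z) ^+ 2 by field.
rewrite (qpoch_inf_sqr _ p1).
have -> : p / - z = - (p / z) by rewrite invrN mulrN.
by rewrite [z ^+ 2 * p]mulrC; ring.
Qed.

End QuintupleLimit.

(** * Index tuples ordered by their total N_1 *)

Section Compositions.

Fixpoint comps (f N : nat) : seq (f.-tuple nat) :=
  match f return seq (f.-tuple nat) with
  | 0 => if N == 0%N then [:: [tuple]] else [::]
  | f'.+1 => [seq cons_tuple n t | n <- iota 0 N.+1, t <- comps f' (N - n)]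
  end.

Lemma mem_comps f N (t : f.-tuple nat) : (t \in comps f N) = (sumn t == N).
Proof.
elim: f N t => [|f IH] N t.
  by rewrite (tuple0 t) /=; case: N => [|N]; rewrite ?mem_seq1 ?eqxx.
apply/allpairsPdep/eqP => [[n [u [nN uN ->]]]|tN].
  move: nN uN; rewrite mem_iota IH /= add0n => nN /eqP ->.
  by rewrite subnKC.
have tE : t = cons_tuple (thead t) (behead_tuple t) by rewrite {1}[t]tuple_eta; apply: val_inj.
exists (thead t), (behead_tuple t); split => //.
  by rewrite mem_iota /= add0n ltnS -tN {2}tE /= leq_addr.
by rewrite IH -tN {2}tE /= addKn.
Qed.

Lemma comps_uniq f N : uniq (comps f N).
Proof.
elim: f N => [|f IH] N; first by rewrite /=; case: ifP.
apply: (@allpairs_uniq_dep _ _ _ (fun n t => cons_tuple n t) (iota 0 N.+1)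
  (fun n => comps f (N - n))) => //; first exact: iota_uniq.
move=> x y /allpairsPdep[n [t [_ _ ->]]] /allpairsPdep[m [u [_ _ ->]]] /=.
by move=> /(congr1 val)/= [-> /val_inj ->].
Qed.

Definition tuples_le (f K : nat) : seq (f.-tuple nat) :=
  [seq t | N <- iota 0 K.+1, t <- comps f N].

Lemma mem_tuples_le f K (t : f.-tuple nat) : (t \in tuples_le f K) = (sumn t <= K)%N.
Proof.
apply/allpairsPdep/idP => [[N [u [NK uN ->]]]|tK].
  by move: NK uN; rewrite mem_iota mem_comps => /andP[_ NK] /eqP ->.
by exists (sumn t), t; split => //; rewrite ?mem_comps ?mem_iota.
Qed.

Lemma tuples_le_uniq f K : uniq (tuples_le f K).
Proof.
apply: allpairs_uniq_dep; [exact: iota_uniq|by move=> N _; exact: comps_uniq|].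
move=> x y /allpairsPdep[N [t [_ tN ->]]] /allpairsPdep[M [u [_ uM ->]]] /= tu.
by move: tN uM; rewrite tu !mem_comps => /eqP <- /eqP <-.
Qed.

End Compositions.

Lemma part_cons f n (t : f.-tuple nat) i : (0 < i)%N ->
  part (cons_tuple n t) i.+1 = part t i.
Proof. by rewrite /part; case: i. Qed.

Lemma tail_sum1 f (t : f.-tuple nat) : tail_sum t 1 = sumn t.
Proof.
rewrite /tail_sum big_add1 sumnE [RHS](big_nth 0%N) size_tuple /=.
by apply: eq_bigr.
Qed.

Lemma tail_sum_cons f n (t : f.-tuple nat) i : (0 < i)%N ->
  tail_sum (cons_tuple n t) i.+1 = tail_sum t i.
Proof.
move=> i0; rewrite /tail_sum big_add1 /=; apply: eq_big_nat => j /andP[ij _].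
by rewrite part_cons// (leq_trans i0).
Qed.

Lemma tail_sum_sq_cons f n (t : f.-tuple nat) :
  tail_sum_sq (cons_tuple n t) = ((n + sumn t) ^ 2 + tail_sum_sq t)%N.
Proof.
rewrite /tail_sum_sq big_ltn// big_add1 /= tail_sum1; congr (_ + _)%N.
by apply: eq_big_nat => j /andP[j0 _]; rewrite tail_sum_cons.
Qed.

Lemma sumn_le_tail_sum_sq f (t : f.-tuple nat) : (0 < f)%N -> (sumn t <= tail_sum_sq t)%N.
Proof.
move=> f0; rewrite /tail_sum_sq big_ltn ?ltnS// tail_sum1.
by rewrite (leq_trans _ (leq_addr _ _))//; nia.
Qed.

Lemma part_le_sumn f (t : f.-tuple nat) i : (part t i <= sumn t)%N.
Proof.
rewrite /part; case: (ltnP i.-1 (size t)) => h; last by rewrite nth_default.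
rewrite sumnE (big_nth 0%N) (bigD1_seq i.-1) ?iota_uniq ?leq_addr//=.
by rewrite mem_index_iota.
Qed.

Lemma abs_bounded_tuple (f : nat) (C : numFieldType) (q : C) : `|q| < 1 ->
  abs_bounded (fun t : f.-tuple nat => q ^+ sumn t).
Proof.
move=> q1; elim: f => [|g IH].
  have := abs_bounded_inj _ (abs_bounded_bool (fun=> (1 : C)))
    (h := fun _ : 0.-tuple nat => true).
  move=> /(_ _)[|M hM]; first by move=> a b _; rewrite (tuple0 a) (tuple0 b).
  by exists M => s us; have := hM s us; congr (_ <= _); apply: eq_bigr => t _;
    rewrite (tuple0 t).
have := abs_bounded_inj _ (abs_bounded_prod (abs_bounded_geometric q1) IH)
    (h := fun t : g.+1.-tuple nat => (thead t, behead_tuple t)).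
move=> /(_ _)[|M hM].
  move=> a b [h1 h2]; rewrite (tuple_eta a) (tuple_eta b) h1; apply: val_inj => /=.
  by congr (_ :: _).
exists M => s us; have := hM s us; congr (_ <= _); apply: eq_bigr => t _ /=.
by rewrite -exprD; congr `|_ ^+ _|; rewrite [in RHS](tuple_eta t).
Qed.

(** * Iteration of Bailey's lemma and evaluation of the multisum *)

Section BaileyChain.
Variable C : numFieldType.
Hypothesis Ccomplete : abs_complete C.
Variable q : C.
Hypothesis q_lt1 : `|q| < 1.
Local Notation e := (inv_qpoch q).
Local Notation qz k := (q ^+ absz k).

Definition alpha (f : nat) (s : int) : C :=
  qz (s * s) ^+ f * (chi3 C s * qz (s * (s + 1))).

Lemma alphaS f s : alpha f.+1 s = qz (s * s) * alpha f s.
Proof. by rewrite /alpha exprS -mulrA. Qed.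

Lemma expr_norm_le m n : (m <= n)%N -> `|q| ^+ n <= `|q| ^+ m.
Proof. by move=> mn; apply: ler_wiXn2l => //; exact: ltW. Qed.

(* The bound holds at s = -1 only because chi3 (-1) = 0. *)
Lemma alpha_bound f s : `|alpha f s| <= 1 * `|q ^+ absz s|.
Proof.
have -> : `|alpha f s| = `|q| ^+ (f * absz (s * s) + absz (s * (s + 1))) * `|chi3 C s|.
  by rewrite /alpha !normrM !normrX exprD -!exprM mulnC; ring.
rewrite mul1r normrX /chi3.
case: ifP => h0; first by rewrite normr1 mulr1 expr_norm_le//; nia.
case: ifP => h1; last by rewrite normr0 mulr0 exprn_ge0.
by rewrite normrN normr1 mulr1 expr_norm_le//; nia.
Qed.

Lemma alpha_abs_bounded f : abs_bounded (alpha f).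
Proof.
exact: abs_bounded_le ler01 (alpha_bound f) (abs_bounded_geometric_int q_lt1).
Qed.

Lemma bailey_alphaS B f N :
  \sum_(0 <= r < N.+1) q ^+ (r ^ 2) * e (N%:Z - r%:Z) * bailey q B (alpha f) r =
  bailey q B (alpha f.+1) N.
Proof.
by rewrite bailey_step//; apply: eq_bisum => s; rewrite alphaS.
Qed.

Lemma shevsum_bailey B (L : nat) :
  shevsum q B (@chi3 C) L = bailey q B (alpha 0) L.
Proof. by apply: eq_bisum => s; rewrite /alpha expr0 mul1r mulrA. Qed.

Lemma bailey_alpha_bounded f : exists2 M, 0 <= M & forall N, `|bailey q N (alpha f) N| <= M.
Proof.
have [A hA] := alpha_abs_bounded f.
have [B B0 hB] := inv_qpoch_int_bounded Ccomplete q_lt1.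
have A0 : 0 <= A by have := hA [::] isT; rewrite big_nil.
exists (A * (B * B)) => [|N]; first by rewrite !mulr_ge0.
rewrite /bailey -sum_int_range (le_trans (ler_norm_sum _ _ _))//.
apply: (@le_trans _ _ (\sum_(s <- int_range N) `|alpha f s| * (B * B))).
  apply: ler_sum => s _; rewrite normrM ler_wpM2l// normrM.
  by apply: ler_pM.
by rewrite -mulr_suml ler_wpM2r ?mulr_ge0// hA// int_range_uniq.
Qed.

(** The contribution of the tuples of length f + 1 with N_1 = N, as [sum_comps_weight] shows. *)
Definition level_sum f (N : nat) : C := q ^+ (N ^ 2) * bailey q N (alpha f) N.

Lemma level_sum_abs_bounded f : abs_bounded (level_sum f).
Proof.
have [M M0 hM] := bailey_alpha_bounded f.
apply: (abs_bounded_le M0 _ (abs_bounded_geometric q_lt1)) => N.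
rewrite normrM mulrC; apply: ler_pM => //.
by rewrite !normrX expr_norm_le//; nia.
Qed.

(** The last Bailey step is taken in the limit: [bailey q K (alpha f.+1) K] is a sum over N_1 with
    weights tending to 1/(q;q)_oo, and a sum over s with weights tending to its square. One factor
    cancels. *)
Lemma multisum_level_sum f :
  multisum (level_sum f) = multisum (alpha f.+1) / qpoch_inf q q.
Proof.
have [B B0 hB] := inv_qpoch_int_bounded Ccomplete q_lt1.
have P0 : qpoch_inf q q != 0 := qpoch_inf_neq0 Ccomplete q_lt1 (qq_neq1 q_lt1).
have h1 : (fun K => bailey q K (alpha f.+1) K) @ \oo --> multisum (level_sum f) / qpoch_inf q q.
  have -> : (fun K => bailey q K (alpha f.+1) K) =
      (fun K => \sum_(N <- iota 0 K.+1) level_sum f N * e (K%:Z - N%:Z)).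
    apply/funext => K; rewrite -bailey_alphaS /index_iota subn0.
    rewrite big_seq [RHS]big_seq; apply: eq_bigr => N; rewrite mem_iota => NK.
    by rewrite /level_sum (bailey_widen _ _ _ (A := K) (B := N)) 1?mulrAC//; lia.
  apply: (tannery Ccomplete (B := B) (level_sum_abs_bounded f)) => //.
  - by move=> N; apply: inv_qpoch_int_cvg => // M; exists (M + N)%N => m; lia.
  - by move=> K; exact: iota_uniq.
  - by move=> K N; rewrite mem_iota => NK; rewrite inv_qpoch_lt0//; lia.
have h2 : (fun K => bailey q K (alpha f.+1) K) @ \oo -->
    multisum (alpha f.+1) * ((qpoch_inf q q)^-1 * (qpoch_inf q q)^-1).
  have -> : (fun K => bailey q K (alpha f.+1) K) =
      (fun K => \sum_(s <- int_range K) alpha f.+1 s * (e (K%:Z - s) * e (K%:Z + s))).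
    by apply/funext => K; rewrite sum_int_range.
  apply: (tannery Ccomplete (B := B * B) (alpha_abs_bounded f.+1)) => //.
  - by move=> K s; rewrite normrM; apply: ler_pM.
  - by move=> s; apply: cvgM; apply: inv_qpoch_int_cvg => // M; exists (M + absz s)%N => m; lia.
  - exact: int_range_uniq.
  - by move=> K s; rewrite mem_int_range => Ks; rewrite inv_qpochM0//; lia.
have := cvg_seq_unique h1 h2; rewrite mulrA.
by apply: mulIf; rewrite invr_eq0.
Qed.

(** The summand of the multisum once the sum over (m, n) is replaced by the Bailey pair's beta at
    n_f. *)
Definition tuple_weight f (t : f.-tuple nat) : C :=
  q ^+ tail_sum_sq t / (\prod_(1 <= i < f) qpoch q q (part t i))
  * bailey q (part t f) (alpha 0) (part t f).

Lemma tuple_weight_cons f n (t : f.+1.-tuple nat) :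
  tuple_weight (cons_tuple n t) = q ^+ ((n + sumn t) ^ 2) * e n%:Z * tuple_weight t.
Proof.
rewrite /tuple_weight tail_sum_sq_cons part_cons// exprD big_ltn// big_add1.
have -> : \prod_(1 <= i < f.+2.-1) qpoch q q (part (cons_tuple n t) i.+1) =
   \prod_(1 <= i < f.+1) qpoch q q (part t i).
  by apply: eq_big_nat => i /andP[i0 _]; rewrite part_cons.
have -> : part (cons_tuple n t) 1 = n by [].
by rewrite inv_qpochE invfM; ring.
Qed.

Lemma sum_comps_weight f N :
  \sum_(t <- comps f.+1 N) tuple_weight t = level_sum f N.
Proof.
elim: f N => [|f IH] N.
  rewrite (perm_big [:: [tuple N]]); last first.
    apply: uniq_perm; rewrite ?comps_uniq// => t; rewrite mem_comps mem_seq1.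
    case: (tupleP t) => n u; rewrite (tuple0 u) /= addn0.
    by apply/eqP/eqP => [->|/(congr1 val)/= []].
  rewrite big_seq1 /tuple_weight /level_sum /part /tail_sum_sq big_nat1 big_geq//.
  by rewrite tail_sum1 /= addn0 divr1.
transitivity (\sum_(n <- iota 0 N.+1) \sum_(t <- comps f.+1 (N - n))
    tuple_weight (cons_tuple n t)); first exact: big_allpairs_dep.
have -> : iota 0 N.+1 = index_iota 0 N.+1 by rewrite /index_iota subn0.
(* After the reversal the index is r = N - n_1 = N_2, the summation variable of the Bailey step. *)
rewrite /level_sum -bailey_alphaS big_distrr [LHS]big_nat_rev/= add0n.
apply: eq_big_nat => r /andP[_ rN]; rewrite subSS.
rewrite (eq_big_seq (fun t : f.+1.-tuple nat => q ^+ (N ^ 2) * e (N%:Z - r%:Z) * tuple_weight t)).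
  rewrite -big_distrr/= IH subKn// /level_sum.
  by rewrite (bailey_widen _ _ _ (A := N) (B := r))//; ring.
move=> t; rewrite mem_comps => /eqP tr; rewrite tuple_weight_cons tr.
have -> : (N - r + (N - (N - r)) = N)%N by lia.
by congr (_ * e _ * _); lia.
Qed.

Section Summands.
Variable f : nat.
Hypothesis f_gt0 : (0 < f)%N.

Definition box (K : nat) : seq (nat * nat * f.-tuple nat) :=
  [seq (mn, t) | mn <- [seq (m, n) | m <- iota 0 K.+1, n <- iota 0 K.+1],
                 t <- tuples_le f K].

Lemma box_uniq K : uniq (box K).
Proof.
apply: allpairs_uniq; [|exact: tuples_le_uniq|by move=> [? ?] [? ?] _ _ /= ->].
by apply: allpairs_uniq; rewrite ?iota_uniq// => -[? ?] [? ?] _ _ /= ->.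
Qed.

Lemma mem_box K (x : nat * nat * f.-tuple nat) : (x.1.1 + x.1.2 + sumn x.2 <= K)%N -> x \in box K.
Proof.
case: x => [[m n] t] /= xK; apply/allpairsP; exists ((m, n), t).
split=> //; last by rewrite mem_tuples_le /=; lia.
by apply/allpairsP; exists (m, n); split => //; rewrite mem_iota /=; lia.
Qed.

(** Exact for every K: the tuples in the box are those with N_1 <= K, and since n_f <= K every (m,
    n) with a non-zero summand lies in the box. *)
Lemma sum_box K :
  \sum_(x <- box K) (summand1 q x + q * summand2 q x) =
  \sum_(N <- iota 0 K.+1) level_sum f.-1 N.
Proof.
rewrite /box big_allpairs_dep exchange_big.
transitivity (\sum_(t <- tuples_le f K) tuple_weight t); last first.
  rewrite /tuples_le big_allpairs_dep; apply: eq_bigr => N _.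
  by case: f f_gt0 => // g _; exact: sum_comps_weight.
rewrite big_seq [RHS]big_seq; apply: eq_bigr => t; rewrite mem_tuples_le => tK.
rewrite big_allpairs_dep.
set L := part t f.
have LK : (L < K.+1)%N by rewrite ltnS (leq_trans (part_le_sumn t f)).
have hb := @transform_bailey C q q_lt1 K.+1 L.+2 L LK (leqnn _).
rewrite shevsum_bailey (bailey_widen _ _ _ (A := L.+2) (B := L)) in hb; try lia.
rewrite /tuple_weight -/L.
have q2 := qpochqq_neq0 q_lt1 (2 * L).
have -> : bailey q L (alpha 0) L = qpoch q q L * transform q K.+1 L / qpoch q q (2 * L).
  by rewrite hb mulrAC divff// mul1r.
rewrite transformE// /index_iota subn0; set r := iota 0 K.+1.
rewrite mulrDr mulrDl mulrDr.
set P := \prod_(1 <= i < f) _.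
under eq_bigr do rewrite big_split/=.
rewrite big_split/=; congr (_ + _).
  rewrite !(big_distrr, big_distrl)/=; apply: eq_bigr => m _.
  rewrite !(big_distrr, big_distrl)/=; apply: eq_bigr => n _.
  by rewrite -/L -/P exprD !invfM; ring.
rewrite !(big_distrr, big_distrl)/=; apply: eq_bigr => m _.
rewrite !(big_distrr, big_distrl)/=; apply: eq_bigr => n _.
by rewrite -/L -/P exprD !invfM; ring.
Qed.

(** All q-Pochhammer factors and their reciprocals are uniformly bounded, and the exponent is at
    least m + n + n_1 + ... + n_f because N_1 <= N_1^2. *)
Lemma summands_abs_bounded : abs_bounded (@summand1 f C q) /\ abs_bounded (@summand2 f C q).
Proof.
have [B1 B10 hB1] := qpoch_bounded Ccomplete q q_lt1.
have [B2 B20 hB2] := inv_qpoch_int_bounded Ccomplete q_lt1.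
have q3 : `|q ^+ 3| < 1 by rewrite normrX exprn_ilt1.
have [B3 B30 hB3] := inv_qpoch_int_bounded Ccomplete q3.
have hB2' n : `|(qpoch q q n)^-1| <= B2 by exact: (hB2 n%:Z).
have hB3' n : `|(qpoch (q ^+ 3) (q ^+ 3) n)^-1| <= B3 by exact: (hB3 n%:Z).
pose y (x : nat * nat * f.-tuple nat) := q ^+ x.1.1 * q ^+ x.1.2 * q ^+ sumn x.2.
have by_ : abs_bounded y.
  exact: abs_bounded_prod (abs_bounded_prod (abs_bounded_geometric q_lt1)
    (abs_bounded_geometric q_lt1)) (abs_bounded_tuple f q_lt1).
have prodB (t : f.-tuple nat) : `|(\prod_(1 <= i < f) qpoch q q (part t i))^-1| <= B2 ^+ (f - 1).
  rewrite -prodfV normr_prod -prodr_const_nat; apply: ler_prod => i _.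
  by rewrite normr_ge0 hB2'.
have D0 : 0 <= B1 * B2 * (B2 * B3 * B2 ^+ (f - 1) * B2) by rewrite !mulr_ge0// exprn_ge0.
have bound (E : nat) (k : int) m n (t : f.-tuple nat) : (m + n + sumn t <= E)%N ->
  `|q ^+ E * qpoch q q (part t f) * e k / (qpoch q q m * qpoch (q ^+ 3) (q ^+ 3) n *
     (\prod_(1 <= i < f) qpoch q q (part t i)) * qpoch q q (2 * part t f))| <=
  B1 * B2 * (B2 * B3 * B2 ^+ (f - 1) * B2) * `|y (m, n, t)|.
  move=> hE; rewrite /y /= -!exprD.
  rewrite [X in `|X| <= _](_ : _ = qpoch q q (part t f) * e k * ((qpoch q q m)^-1 *
     (qpoch (q ^+ 3) (q ^+ 3) n)^-1 * (\prod_(1 <= i < f) qpoch q q (part t i))^-1 *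
     (qpoch q q (2 * part t f))^-1) * q ^+ E); last by rewrite !invfM; ring.
  rewrite normrM; apply: ler_pM => //; last by rewrite !normrX expr_norm_le.
  rewrite !normrM; do ! (apply: ler_pM => //; rewrite ?mulr_ge0 ?exprn_ge0//).
by split; apply: (abs_bounded_le D0 _ by_) => -[[m n] t]; apply: bound;
  have := sumn_le_tail_sum_sq t f_gt0; nia.
Qed.

Lemma multisum_summands :
  multisum (@summand1 f C q) + q * multisum (@summand2 f C q) =
  multisum (alpha f) / qpoch_inf q q.
Proof.
have [b1 b2] := summands_abs_bounded.
have boxE (x : nat * nat * f.-tuple nat) : \forall K \near \oo, x \in box K.
  by exists (x.1.1 + x.1.2 + sumn x.2)%N => // K /= xK; exact: mem_box.
have h1 := multisum_exhaust Ccomplete b1 box_uniq boxE.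
have h2 := multisum_exhaust Ccomplete b2 box_uniq boxE.
have h3 : (fun K => \sum_(x <- box K) (summand1 q x + q * summand2 q x)) @ \oo -->
    multisum (@summand1 f C q) + q * multisum (@summand2 f C q).
  under eq_fun do rewrite big_split/= -big_distrr/=.
  by apply: cvgD h1 _; apply: cvgM h2; exact: cvg_cst.
have h4 : (fun K => \sum_(x <- box K) (summand1 q x + q * summand2 q x)) @ \oo -->
    multisum (level_sum f.-1).
  under eq_fun do rewrite sum_box.
  apply: (multisum_exhaust Ccomplete (level_sum_abs_bounded _)) => [K|N].
    exact: iota_uniq.
  exists N => // K NK; suff : N \in iota 0 K.+1 by [].
  by rewrite mem_iota /= add0n ltnS.
by rewrite (cvg_seq_unique h3 h4) multisum_level_sum prednK.
Qed.

End Summands.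

Lemma sum_nat_mul3 (V : zmodType) (F : nat -> V) n :
  \sum_(0 <= i < 3 * n) F i =
  \sum_(0 <= k < n) (F (3 * k)%N + F (3 * k + 1)%N + F (3 * k + 2)%N).
Proof.
elim: n => [|n IH]; first by rewrite muln0 !big_nil.
have -> : (3 * n.+1 = (3 * n).+3)%N by lia.
rewrite [RHS]big_nat_recr//= -IH !big_nat_recr//= !addrA.
by rewrite addn1 addn2.
Qed.

Lemma expfz_neq1 (k : int) : q != 0 -> k != 0 -> q ^ k != 1.
Proof.
move=> q0; case: k => [[|n]|n] // _.
  by rewrite -exprnP exprS qq_neq1.
by rewrite NegzE -exprnN invr_eq1 exprS qq_neq1.
Qed.

(** The residues 0 and 1 of s modulo 3 give the two parts of 1 - z p^j, and residue 2 gives 0.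
    Matching the exponents (f+1) s^2 + s at s = 3j and s = 3j + 1 forces p = q^(6f+6) and z =
    q^(f+2). *)
Lemma alpha_quintuple f (j : int) : q != 0 ->
  quintuple_term (q ^+ (6 * f + 6)) (q ^+ (f + 2)) j =
  alpha f (3 * j) + alpha f (3 * j + 1) + alpha f (3 * j + 2).
Proof.
move=> q0.
have alphaE s : alpha f s = chi3 C s * q ^ (f%:Z * (s * s) + s * (s + 1)).
  have s1 : 0 <= s * s by nia.
  have s2 : 0 <= s * (s + 1) by nia.
  rewrite /alpha mulrCA; congr (_ * _).
  case: (s * s) (s * (s + 1)) s1 s2 => // a [] // b _ _.
  by rewrite -PoszM -PoszD -exprnP -exprM -exprD mulnC.
rewrite !alphaE.
have -> : chi3 C (3 * j) = 1 by rewrite /chi3; have -> : ((3 * j) %% 3 = 0)%Z by lia.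
have -> : chi3 C (3 * j + 1) = -1 by rewrite /chi3; have -> : ((3 * j + 1) %% 3 = 1)%Z by lia.
have -> : chi3 C (3 * j + 2) = 0 by rewrite /chi3; have -> : ((3 * j + 2) %% 3 = 2)%Z by lia.
rewrite mul0r addr0 mul1r mulN1r /quintuple_term !exprnP !exprz_exp.
rewrite !mulrBl mul1r -!expfzDr//.
have hj : 2 * ((j * (3 * j - 1)) %/ 2)%Z = j * (3 * j - 1).
  suff [X ->] : exists X, j * (3 * j - 1) = 2 * X by lia.
  have [k [->|->]] : exists k, j = 2 * k \/ j = 2 * k + 1.
    by exists (j %/ 2)%Z; lia.
  - by exists (k * (6 * k - 1)); ring.
  - by exists ((2 * k + 1) * (3 * k + 1)); ring.
congr (q ^ _ - q ^ _); nia.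
Qed.

Lemma quintuple_abs_bounded f : (0 < f)%N -> q != 0 ->
  abs_bounded (quintuple_term (q ^+ (6 * f + 6)) (q ^+ (f + 2))).
Proof.
move=> f0 q0.
apply: (abs_bounded_le (c := 3) _ _ (abs_bounded_geometric_int q_lt1)) => [|j].
  exact: ler0n.
have le3 s : (absz j <= absz s)%N -> `|alpha f s| <= `|q ^+ absz j|.
  move=> js; have := alpha_bound f s; rewrite mul1r => /le_trans; apply.
  by rewrite !normrX expr_norm_le.
rewrite alpha_quintuple//.
have -> : 3 * `|q ^+ absz j| = `|q ^+ absz j| + `|q ^+ absz j| + `|q ^+ absz j| by ring.
rewrite (le_trans (ler_normD _ _))// lerD//; last by apply: le3; lia.
by rewrite (le_trans (ler_normD _ _))// lerD//; apply: le3; lia.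
Qed.

Lemma qpoch_inf0 (p : C) : qpoch_inf 0 p = 1.
Proof.
apply: cvg_lim => //; rewrite (_ : qpoch 0 p = fun=> 1); first exact: cvg_cst.
apply/funext => n; rewrite /qpoch big1// => k _; by rewrite mul0r subr0.
Qed.

Lemma multisum_alpha f : (0 < f)%N ->
  multisum (alpha f) =
  qpochs_inf [:: q ^+ (f + 2); q ^+ (5 * f + 4); q ^+ (6 * f + 6)] (q ^+ (6 * f + 6))
  * qpochs_inf [:: q ^+ (4 * f + 2); q ^+ (8 * f + 10)] (q ^+ (12 * f + 12)).
Proof.
(* The quintuple product divides by p and z. At q = 0 only the term s = 0 survives and both sides
   are 1. *)
move=> f0; have [q0|q0] := eqVneq q 0.
  have exp0 k : (0 < k)%N -> q ^+ k = 0 by move=> k0; rewrite q0 expr0n -[k]prednK.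
  rewrite !exp0 ?addnS// /qpochs_inf !big_cons !big_nil !qpoch_inf0 !mulr1.
  have h : (fun K => \sum_(s <- int_range K) alpha f s) @ \oo --> multisum (alpha f).
    apply: (multisum_exhaust Ccomplete (alpha_abs_bounded f)); first exact: int_range_uniq.
    by move=> s; exists (absz s) => // K; rewrite mem_int_range.
  apply: cvg_seq_unique h _.
  rewrite (_ : (fun K => _) = fun=> 1); first exact: cvg_cst.
  apply/funext => K; rewrite (bigD1_seq 0) ?int_range_uniq ?mem_int_range//= big1 ?addr0.
    by rewrite /alpha /chi3 /= !expr0 expr1n !mulr1.
  by move=> s s0; rewrite /alpha (exp0 (absz (s * s))) ?expr0n ?gtn_eqF// ?mul0r//; nia.
have Q0 : q ^+ (6 * f + 6) != 0 by rewrite expf_neq0.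
have Q1 : `|q ^+ (6 * f + 6)| < 1 by rewrite normrX exprn_ilt1// addnS.
have z0 : q ^+ (f + 2) != 0 by rewrite expf_neq0.
have hz (i : int) : (q ^+ (f + 2)) ^+ 2 * q ^+ (6 * f + 6) ^ i != 1.
  rewrite -exprM !exprnP exprz_exp -expfzDr// expfz_neq1//.
  (* The exponent 2(f+2) + (6f+6) i is positive for i >= 0 and at most -(4f+2) for i <= -1. *)
  have [i0|i0] : 0 <= i \/ i <= -1 by lia.
    have : 0 <= (6 * f + 6)%:Z * i by rewrite mulr_ge0.
    lia.
  have : (6 * f + 6)%:Z * i <= (6 * f + 6)%:Z * (-1) by rewrite ler_wpM2l.
  lia.
have bterm := quintuple_abs_bounded f0 q0.
have <- : multisum (quintuple_term (q ^+ (6 * f + 6)) (q ^+ (f + 2))) = multisum (alpha f).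
  have h1 : (fun K => \sum_(j <- int_range K) quintuple_term (q ^+ (6 * f + 6)) (q ^+ (f + 2)) j)
      @ \oo --> multisum (quintuple_term (q ^+ (6 * f + 6)) (q ^+ (f + 2))).
    apply: (multisum_exhaust Ccomplete bterm); first exact: int_range_uniq.
    by move=> s; exists (absz s) => // K; rewrite mem_int_range.
  (* The window -3K <= s <= 3K + 2 contains exactly the triples 3j, 3j + 1, 3j + 2 with |j| <= K. *)
  pose E K := [seq i%:Z - (3 * K)%:Z | i <- iota 0 (3 * (2 * K).+1)].
  have h2 : (fun K => \sum_(s <- E K) alpha f s) @ \oo --> multisum (alpha f).
    apply: (multisum_exhaust Ccomplete (alpha_abs_bounded f)).
      by move=> K; rewrite map_inj_uniq ?iota_uniq// => i j; lia.
    move=> s; exists (absz s) => // K sK; have {}sK : (absz s <= K)%N := sK.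
    apply/mapP; exists (absz (s + (3 * K)%:Z)); first by rewrite mem_iota; lia.
    by lia.
  apply: cvg_seq_unique h1 _; rewrite (_ : (fun K => _) = fun K => \sum_(s <- E K) alpha f s)//.
  apply/funext => K; rewrite sum_int_range /bisum /E big_map.
  have -> : iota 0 (3 * (2 * K).+1) = index_iota 0 (3 * (2 * K).+1) by rewrite /index_iota subn0.
  rewrite sum_nat_mul3; apply: eq_bigr => i _; rewrite alpha_quintuple//.
  by congr (alpha f _ + alpha f _ + alpha f _); lia.
rewrite (quintuple_product Ccomplete Q0 Q1 z0 hz bterm).
have divE a b c : (a = b + c)%N -> q ^+ a / q ^+ b = q ^+ c.
  by move=> ->; rewrite exprD mulrAC divff ?mul1r// expf_neq0.
rewrite -!exprM -exprD (divE _ _ (5 * f + 4)%N); last by lia.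
rewrite (divE _ _ (4 * f + 2)%N); last by lia.
by congr (qpochs_inf _ _ * qpochs_inf [:: _; q ^+ _] (q ^+ _)); lia.
Qed.

End BaileyChain.

Theorem theorem24 (R : realType) (f : nat) (q : R[i])
    (f_gt0 : (0 < f)%N) (q_lt1 : `|q| < 1) :
  [/\ is_summable (@summand1 f _ q),
      is_summable (@summand2 f _ q) &
      multisum (@summand1 f _ q) + q * multisum (@summand2 f _ q) =
      qpochs_inf [:: q ^+ (f + 2); q ^+ (5 * f + 4); q ^+ (6 * f + 6)]
                 (q ^+ (6 * f + 6))
      * qpochs_inf [:: q ^+ (4 * f + 2); q ^+ (8 * f + 10)]
                   (q ^+ (12 * f + 12))
      / qpoch_inf q q].
Proof.
have Ccomplete := @complex_abs_complete R.
have [b1 b2] := summands_abs_bounded Ccomplete q_lt1 f_gt0.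
split; [exact: (Ccomplete _ _ b1)|exact: (Ccomplete _ _ b2)|].
by rewrite (multisum_summands Ccomplete q_lt1 f_gt0) (multisum_alpha Ccomplete q_lt1 f_gt0).
Qed.
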